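(* Let $\Gamma\subset\Gamma_0(q)$ be any congruence subgroup of level $q$, and let $\omega=\omega_\Gamma$ be the width of the cusp $\infty$ of $\Gamma$. Let $\mathscr B_2(\Gamma)$ be an orthonormal basis of $S_2(\Gamma)$, let $K\ge2$, and let $a=(a_n)$ be a sequence of complex numbers. (A) One has $$\sum_{f\in\mathscr B_2(\Gamma)}|\mathcal L(f,a)|^2\ll\frac1{\omega^2}\Big(\log K+O\Big(\frac K{q\omega}\Big)\Big)\|a\|^2 .$$ (B) Assume in addition that the Kloosterman sums of $\Gamma$ satisfy, for every $\epsilon>0$, $$S_\Gamma(m,n;c)\ll(c\omega)^{1/2+\epsilon}(m,n,c\omega)^{1/2}.$$ Then $$\sum_{f\in\mathscr B_2(\Gamma)}|\mathcal L(f,a)|^2\ll\frac1{\omega^{2-\epsilon}}\Big(1+O\Big(\frac K{q\omega}\Big)\Big)\|a\|^2 .$$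
   Context: $\Gamma_0(q)\subset\mathrm{SL}_2(\mathbf Z)$ is the subgroup of matrices with lower-left entry divisible by $q$. A congruence subgroup contains some principal congruence subgroup $\Gamma(q)$; its level is the smallest such $q\ge1$. The width $\omega$ of $\Gamma$ at $\infty$ is the smallest positive integer with $\pm\begin{pmatrix}1&\omega\\0&1\end{pmatrix}\in\Gamma$. $S_2(\Gamma)$ is the space of holomorphic cusp forms of weight $2$ on $\Gamma$, with inner product $\langle f,g\rangle=\int_{\Gamma\backslash\mathbf H}f(z)\overline{g(z)}\,dx\,dy$ (not volume normalized). For $f(z)=\sum_{n\ge1}a_f(n)e(nz/\omega)\in S_2(\Gamma)$, $e(z)=e^{2\pi iz}$, put $a(f,n)=a_f(n)/(4\pi n)^{1/2}$, $\mathcal L(f,a)=\sum_{n\le K}a_na(f,n)$, and $\|a\|^2=\sum_{n\le K}|a_n|^2$. For $c\ge1$ the Kloosterman sum of $\Gamma$ at $\infty$ is $S_\Gamma(m,n;c)=\sum_{d\in D(c)}e\big(\frac{m\bar d+nd}{c\omega}\big)$, where $D(c)=\{d\in\mathbf Z: (c,d)\text{ is the bottom row of some }\gamma\in\Gamma,\ d\in[0,c\omega]\}$ (representatives modulo $c\omega$), and $\bar d$ is the upper-left entry, modulo $c\omega$, of such a $\gamma$. $(m,n,c\omega)$ is the greatest common divisor. Implied constants are absolute, except for a dependence on $\epsilon$ in (B). *)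

(* Defs.v *)
From HB Require Import structures.
From mathcomp Require Import all_boot all_order all_algebra.
From mathcomp Require Import all_classical all_reals all_analysis.
From mathcomp Require Import complex.

Set Implicit Arguments.
Unset Strict Implicit.
Unset Printing Implicit Defensive.

Import Order.TTheory GRing.Theory Num.Theory.
Import numFieldNormedType.Exports.
Import ComplexField.Normc.

#[global] Open Scope classical_set_scope.
#[global] Open Scope complex_scope.
#[global] Open Scope ring_scope.

Definition is_least (P : nat -> Prop) (n : nat) : Prop :=
  P n /\ forall m, P m -> (n <= m)%N.

Section CongruenceSubgroups.

Definition SL2Z : set 'M[int]_2 := [set g | \det g = 1].

Definition is_subgroup (G : set 'M[int]_2) : Prop :=
  [/\ G `<=` SL2Z, G 1, forall g h, G g -> G h -> G (g * h)
    & forall g, G g -> G (invmx g)].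

Definition principal_congruence (N : nat) : set 'M[int]_2 :=
  [set g | SL2Z g /\ forall i j, (N %| (g i j - (1 : 'M[int]_2) i j)%R)%Z].

Definition Gamma0 (q : nat) : set 'M[int]_2 :=
  [set g | SL2Z g /\ (q %| g 1%R 0%R)%Z].

Definition is_congruence_subgroup (G : set 'M[int]_2) : Prop :=
  is_subgroup G /\ exists N : nat, (0 < N)%N /\ principal_congruence N `<=` G.

Definition is_level (G : set 'M[int]_2) (q : nat) : Prop :=
  is_least (fun N => (0 < N)%N /\ principal_congruence N `<=` G) q.

(* the matrix ((1, w), (0, 1)) *)
Definition unipotent (w : nat) : 'M[int]_2 := 1 + w%:Z *: delta_mx 0 1.

Definition is_width (G : set 'M[int]_2) (w : nat) : Prop :=
  is_least (fun v => (0 < v)%N /\ (G (unipotent v) \/ G (- unipotent v))) w.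

End CongruenceSubgroups.

Section CuspForms.
Variable R : realType.

Definition cexp (z : R[i]) : R[i] :=
  (expR (complex.Re z))%:C * (cos (complex.Im z) +i* sin (complex.Im z)).

Definition e (z : R[i]) : R[i] := cexp ((2 * pi)%:C * 'i%C * z).

Definition upper_half_plane : set R[i] := [set z | 0 < complex.Im z].

Definition mobius (g : 'M[int]_2) (z : R[i]) : R[i] :=
  ((g 0 0)%:~R * z + (g 0 1)%:~R) / ((g 1 0)%:~R * z + (g 1 1)%:~R).

(* (f |_2 g)(z) *)
Definition slash2 (g : 'M[int]_2) (f : R[i] -> R[i]) (z : R[i]) : R[i] :=
  ((g 1 0)%:~R * z + (g 1 1)%:~R) ^- 2 * f (mobius g z).

Definition fourier_expansion (w : nat) (f : R[i] -> R[i]) (b : nat -> R[i]) :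
    Prop :=
  forall z, upper_half_plane z ->
    (fun N : nat =>
       (\sum_(1 <= n < N.+1) b n * e (n%:R * z / w%:R) : R[i]^o)) @ \oo
      --> (f z : R[i]^o).

(* Values of f outside the upper half-plane are irrelevant. Holomorphy and
   vanishing at the cusp g(oo) say that f |_2 g has a Fourier expansion
   without terms of index n <= 0, in e(z/N) for some N. *)
Definition cusp_form2 (G : set 'M[int]_2) (f : R[i] -> R[i]) : Prop :=
  [/\ forall z, upper_half_plane z -> derivable (f : R[i]^o -> R[i]^o) z 1,
      forall g z, G g -> upper_half_plane z -> slash2 g f z = f z
    & forall g, SL2Z g ->
        exists (N : nat) (b : nat -> R[i]),
          (0 < N)%N /\ fourier_expansion N (slash2 g f) b].

Definition cpx (p : R * R) : R[i] := p.1 +i* p.2.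

Definition plane_measure :=
  ((@lebesgue_measure R) \x (@lebesgue_measure R))%E.

(* A measurable set of representatives for G \ H; the integral over G \ H of
   a G-invariant measure on H is the integral over any such set. *)
Definition fundamental_domain (G : set 'M[int]_2) (F : set R[i]) : Prop :=
  [/\ measurable (cpx @^-1` F : set (measurableTypeR R * measurableTypeR R)),
      F `<=` upper_half_plane
    & forall z, upper_half_plane z ->
        exists! w, F w /\ exists2 g, G g & w = mobius g z].

Definition petersson (F : set R[i]) (f g : R[i] -> R[i]) : R[i] :=
  let h p := f (cpx p) * (g (cpx p))^*%C in
  (\int[plane_measure]_(p in cpx @^-1` F) complex.Re (h p))
  +i* (\int[plane_measure]_(p in cpx @^-1` F) complex.Im (h p)).

(* F is a fundamental domain of G, used to integrate over G \ H. *)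
Definition orthonormal_basis (G : set 'M[int]_2) (F : set R[i]) (k : nat)
    (f : 'I_k -> R[i] -> R[i]) : Prop :=
  [/\ forall j, cusp_form2 G (f j),
      forall i j, petersson F (f i) (f j) = (i == j)%:R
    & forall g, cusp_form2 G g ->
        exists c : 'I_k -> R[i], forall z, upper_half_plane z ->
          g z = \sum_(j < k) c j * f j z].

(* af is the sequence of Fourier coefficients of f; the sums over n <= K with
   K real run over 1 <= n <= floor K. *)
Definition linform (af a : nat -> R[i]) (K : R) : R[i] :=
  \sum_(1 <= n < (Num.truncn K).+1)
    a n * (af n / (Num.sqrt (4 * pi * n%:R))%:C).

Definition sqnorm (a : nat -> R[i]) (K : R) : R :=
  \sum_(1 <= n < (Num.truncn K).+1) normc (a n) ^+ 2.

Definition upper_left (G : set 'M[int]_2) (c d : int) : set int :=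
  [set g 0 0 | g in [set g | [/\ G g, g 1 0 = c & g 1 1 = d]]].

(* Modulo c * w, the upper-left entry does not depend on the choice made by
   xget when w is the width of G. *)
Definition kloosterman (G : set 'M[int]_2) (w : nat) (m n : int) (c : nat) :
    R[i] :=
  \sum_(d < (c * w)%N | `[< upper_left G c%:Z (d : nat)%:Z !=set0 >])
    e ((m * xget 0 (upper_left G c%:Z (d : nat)%:Z) + n * (d : nat)%:Z)%:~R
       / (c * w)%:R).

Definition kloosterman_bound (G : set 'M[int]_2) (w : nat) (A : R -> R) :
    Prop :=
  forall (eps : R), 0 < eps -> forall (m n : int) (c : nat), (0 < c)%N ->
    normc (kloosterman G w m n c) <=
      A eps * (c * w)%:R `^ (2^-1 + eps)
      * Num.sqrt (gcdz (gcdz m n) (c * w)%:Z)%:~R.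

End CuspForms.

(* Main.v *)
(* By duality it suffices to bound, for a cusp form g = sum_j c_j f_j with
   Fourier coefficients b(n), the sum over n <= K of |b(n)|^2 / (4 pi n) by a
   multiple of the Petersson norm of g. Parseval's identity on horizontal lines
   bounds w^2 times this sum by e^(4 pi) times the integral of |g|^2 over the
   strip 0 < x <= w, y >= w / K. Folding the strip onto a fundamental domain
   multiplies the norm of g by at most the number of group elements carrying a
   given point into the strip, and counting bottom rows (c, d) with q | c bounds
   this number by 2 + 6 K / (q w). This gives w^-2 (1 + K / (q w)), which implies
   both parts.
   The invariance of dx dy / y^2 under z -> - 1 / z reduces to one-dimensional
   substitutions, which follow from the uniqueness of the Haar measure of the
   multiplicative group of positive reals. *)
Require Import Defs.
From mathcomp Require Import all_boot all_order all_algebra.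
From mathcomp Require Import all_classical all_reals all_analysis.
From mathcomp Require Import complex.
From mathcomp Require Import measurable_realfun ring lra.
Set Implicit Arguments.
Unset Strict Implicit.
Unset Printing Implicit Defensive.
Import Order.TTheory GRing.Theory Num.Theory.
Import numFieldNormedType.Exports.
Import ComplexField.Normc.

Local Open Scope classical_set_scope.
Local Open Scope ring_scope.

(** * Substitutions on the line *)

(** The height $w/K$ is dictated by the factor $e^{-4\pi ny/w}$ that $|b(n)|^2$ carries on the line
    of height $y$: there it is still at least $e^{-4\pi}$ for every $n\le K$, while a lower strip
    would be covered more often. One factor $w$ is the length of the horizontal segment; the other
    comes from $\int e^{-4\pi ny/w}\,dy$, which also produces the weight $1/(4\pi n)$ of the linear
    forms.

    Folding is needed only as an inequality: some group element carries a given point into the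
    fundamental domain, so a sum over the whole group may overcount, and neither stabilizers nor
    $-1$ call for separate treatment.

    The inversion $z\mapsto-1/z$ mixes the two coordinates. In terms of $x$ and $s=|z|^2$ it becomes
    $(x,s)\mapsto(-x/s,1/s)$: a dilation of $x$ at fixed $s$, then a substitution in $s$ alone.
    Passing from $y$ to $s$ costs a constant that stands on both sides and is never evaluated.

    Finally $1\le\log K/\log2$ turns the bound into (A), and $w^{-2}\le w^{-2+\epsilon}$ turns it
    into (B). *)

Section LineIntegrals.
Variable R : realType.
Notation leb := (@lebesgue_measure R).
Local Open Scope ereal_scope.

Lemma measurable_invr : measurable_fun [set: R] (@GRing.inv R).
Proof.
have -> : [set: R] = [set~ 0%R] `|` [set 0%R] by rewrite setUC setUv.
apply/measurable_funU => //; first exact: measurableC.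
split; last exact: measurable_fun_set1.
apply: subspace_continuous_measurable_fun; first exact: measurableC.
apply: continuous_in_subspaceT => x /set_mem/eqP.
exact: inv_continuous.
Qed.

(** The right-hand side is itself a measure in [A], and it gives half-open intervals their length;
    Lebesgue measure is the only one that does. *)
Lemma lebesgue_measure_affine (a b : R) (A : set R) : a != 0%R ->
  measurable A ->
  leb A = `|a|%:E * leb ((fun x => a * x + b)%R @^-1` A).
Proof.
move=> a0 mA.
have mphi : measurable_fun setT (fun x : R => (a * x + b)%R).
  by apply: measurable_funD => //; apply: measurable_funM.
suff -> : leb A = pushforward (mscale (NngNum (normr_ge0 a)) leb)
    ((fun x : R => a * x + b)%R : _ -> measurableTypeR R) A by [].
apply: lebesgue_measure_unique => //= _ [[u v]] _ <-.
rewrite /pushforward /mscale/=.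
have [a1|a1] := ltP 0%R a.
- have -> : ((fun x => a * x + b)%R @^-1` `]u, v]) = [set` `]((u - b) / a)%R, ((v - b) / a)%R]].
    apply/seteqP; split => x /=; rewrite !in_itv/= ltr_pdivrMr// ler_pdivlMr//;
    by rewrite ltrBlDr lerBrDr mulrC.
  rewrite !lebesgue_measure_itv/= !lte_fin ltr_pM2r ?invr_gt0// ltrD2r.
  case: ifPn => _; last by rewrite mule0.
  rewrite !EFinN -!EFinB -EFinM; congr EFin.
  by rewrite gtr0_norm//; field.
- have a2 : (a < 0)%R by rewrite lt_neqAle a0.
  have -> : ((fun x => a * x + b)%R @^-1` `]u, v]) = [set` `[((v - b) / a)%R, ((u - b) / a)%R[].
    apply/seteqP; split => x /=; rewrite !in_itv/= ler_ndivrMr// ltr_ndivlMr//;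
    by rewrite ltrBlDr lerBrDr mulrC andbC.
  rewrite !lebesgue_measure_itv/= !lte_fin ltr_nM2r ?invr_lt0// ltrD2r.
  case: ifPn => _; last by rewrite mule0.
  rewrite !EFinN -!EFinB -EFinM; congr EFin.
  by rewrite ltr0_norm//; field.
Qed.

Lemma ge0_integral_affine (f : R -> \bar R) (a b : R) : a != 0%R ->
  measurable_fun setT f -> (forall x, 0 <= f x) ->
  \int[leb]_x f x = `|a|%:E * \int[leb]_x f (a * x + b)%R.
Proof.
move=> a0 mf f0.
have mphi : measurable_fun setT (fun x : R => (a * x + b)%R).
  by apply: measurable_funD => //; apply: measurable_funM.
rewrite (eq_measure_integral (pushforward (mscale (NngNum (normr_ge0 a)) leb)
    ((fun x : R => a * x + b)%R : _ -> measurableTypeR R))); last first.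
  move=> A mA _; exact: lebesgue_measure_affine.
rewrite ge0_integral_pushforward//.
rewrite preimage_setT ge0_integral_mscale//; first exact: measurableT_comp.
by move=> x _; exact: f0.
Qed.

Lemma integral_swap (w : R -> R -> R) :
  measurable_fun setT (fun p : R * R => w p.1 p.2) ->
  (forall x y, 0 <= w x y)%R ->
  \int[leb]_x \int[leb]_y (w x y)%:E = \int[leb]_y \int[leb]_x (w x y)%:E.
Proof.
move=> mw w0.
apply: (@fubini_tonelli _ _ _ _ _ leb leb (fun p : R * R => (w p.1 p.2)%:E)).
  exact/measurable_EFinP.
by move=> p; rewrite lee_fin.
Qed.

Lemma integral_plane (w : R -> R -> R) :
  measurable_fun setT (fun p : R * R => w p.1 p.2) ->
  (forall x y, 0 <= w x y)%R ->
  \int[@plane_measure R]_p (w p.1 p.2)%:E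
    = \int[leb]_x \int[leb]_y (w x y)%:E.
Proof.
move=> mw w0.
apply: (@fubini_tonelli1 _ _ _ _ _ leb leb (fun p : R * R => (w p.1 p.2)%:E)).
  exact/measurable_EFinP.
by move=> p; rewrite lee_fin.
Qed.

Lemma measurable_section (w : R -> R -> R) :
  measurable_fun setT (fun p : R * R => w p.1 p.2) ->
  forall x, measurable_fun setT (w x).
Proof.
move=> mw x; apply: (measurableT_comp (g := fun y : R => (x, y)) mw).
exact: pair1_measurable.
Qed.

(* [x^-1 dx] on [x > 0] is the Haar measure of the multiplicative group. *)
Definition haar (x : R) : R := if (0 < x)%R then x^-1%R else 0%R.

Lemma haar_ge0 x : (0 <= haar x)%R.
Proof. by rewrite /haar; case: ifP => // /ltW; rewrite invr_ge0. Qed.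

Lemma measurable_haar : measurable_fun setT haar.
Proof.
apply: measurable_fun_ifT => //; last exact: measurable_invr.
exact: measurable_fun_ltr.
Qed.

(** The Jacobian [t] is absorbed by [haar (t * y) = haar y / t]. *)
Lemma haar_scale (h : R -> R) (t : R) : (0 < t)%R ->
  measurable_fun setT h -> (forall x, 0 <= h x)%R ->
  \int[leb]_y (haar y * h (t * y))%:E = \int[leb]_y (haar y * h y)%:E.
Proof.
move=> t0 mh h0.
have mhh : measurable_fun setT (fun y => (haar y * h y)%:E).
  by apply/measurable_EFinP/measurable_funM => //; exact: measurable_haar.
have hh0 y : 0 <= (haar y * h y)%:E by rewrite lee_fin mulr_ge0// haar_ge0.
have maff : measurable_fun setT (fun y : R => (t * y + 0)%R).
  by apply: measurable_funD => //; apply: measurable_funM.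
have mt : measurable_fun setT (fun y => (haar (t * y + 0) * h (t * y + 0))%:E).
  exact: (measurableT_comp mhh maff).
rewrite [RHS](@ge0_integral_affine _ t 0%R) ?gt_eqF//.
rewrite -ge0_integralZl//.
apply: eq_integral => y _; rewrite addr0 -EFinM mulrA; congr (_ * _)%:E.
rewrite /haar pmulr_rgt0// gtr0_norm//; case: ifP => y0; last by rewrite mulr0.
by field; rewrite !gt_eqF.
Qed.

(** A test function of total Haar mass 1: its product with [haar] is the indicator of []0, 1]].
    Inserted as a factor 1, it provides the second variable for the uniqueness argument. *)
Definition haar_bump (x : R) : R := if (0 < x <= 1)%R then x else 0%R.

Lemma haar_bump_ge0 x : (0 <= haar_bump x)%R.
Proof. by rewrite /haar_bump; case: ifP => // /andP[/ltW]. Qed.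

Lemma measurable_haar_bump : measurable_fun setT haar_bump.
Proof.
apply: measurable_fun_ifT => //.
by apply: measurable_and; [exact: measurable_fun_ltr|exact: measurable_fun_ler].
Qed.

Lemma integral_haar_bump : \int[leb]_x (haar x * haar_bump x)%:E = 1.
Proof.
transitivity (\int[leb]_x (\1_(`]0%R, 1%R] : set R) x)%:E).
  apply: eq_integral => x _; congr EFin.
  rewrite /haar /haar_bump indicE mem_setE in_itv/=.
  by case: ltP => /= x0; rewrite ?mul0r//; case: ifP => _; rewrite ?mulr0// mulVf// gt_eqF.
rewrite integral_indic// setIT.
rewrite [LHS]lebesgue_measure_itv/= lte_fin ltr01.
by rewrite sube0.
Qed.

(* Uniqueness of Haar measure: [theta] carries the multiplicative translations
   to multiplicative translations, so it only rescales [haar x dx]. *)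
Lemma haar_substitution (theta F : R -> R) :
  measurable_fun setT theta -> (forall y, 0 < y -> 0 < theta y)%R ->
  (forall b, 0 < b -> exists2 t, 0 < t &
    forall y, 0 < y -> theta (t * y) = b * theta y)%R ->
  measurable_fun setT F -> (forall x, 0 <= F x)%R ->
  \int[leb]_y (haar y * F (theta y))%:E =
  \int[leb]_y (haar y * haar_bump (theta y)^-1)%:E *
    \int[leb]_x (haar x * F x)%:E.
Proof.
move=> mth th0 Hth mF F0.
have mh := measurable_haar; have mb := measurable_haar_bump.
have mi := measurable_invr.
have h0 := haar_ge0; have b0 := haar_bump_ge0.
have m1 : measurable_fun setT (fst : R * R -> R) by exact: measurable_fst.
have m2 : measurable_fun setT (snd : R * R -> R) by exact: measurable_snd.
have mFth : measurable_fun setT (F \o theta) by exact: measurableT_comp.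
have mhb : measurable_fun setT (fun x => haar x * haar_bump x)%R.
  exact: measurable_funM.
have hb0 x : (0 <= haar x * haar_bump x)%R by rewrite mulr_ge0.
have mbth (b : R) : measurable_fun setT (fun y => haar_bump (b / theta y)).
  apply: (measurableT_comp mb); apply: measurable_funM => //.
  exact: (measurableT_comp mi).
(* At fixed [b], replace [y] by [t * y], where [theta (t * y) = b * theta y]. *)
have step1 b : \int[leb]_y (haar b * haar_bump b * (haar y * F (theta y)))%:E
    = \int[leb]_y (haar b * haar_bump b * (haar y * F (b * theta y)))%:E.
  have [b_gt0|b_le0] := ltP 0%R b; last first.
    by apply: eq_integral => y _; rewrite /haar ltNge b_le0/= !mul0r.
  have [t t0 Ht] := Hth b b_gt0.
  under eq_integral do rewrite mulrCA.
  rewrite -(@haar_scale (fun y => haar b * haar_bump b * F (theta y))%R t)//; last 2 first.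
  - by apply: measurable_funM => //; exact: mFth.
  - by move=> x; rewrite mulr_ge0.
  apply: eq_integral => y _; rewrite mulrCA.
  have [y0|y0] := ltP 0%R y; first by rewrite Ht.
  by rewrite /haar [(0 < y)%R]ltNge y0/= !mul0r mulr0.
(* At fixed [y], replace [b] by [b / theta y]: the argument of [F] no longer involves [y]. *)
have step2 y : \int[leb]_b (haar b * haar_bump b * (haar y * F (b * theta y)))%:E
    = \int[leb]_b (haar b * (haar_bump (b / theta y) * haar y * F b))%:E.
  have [y0|y0] := ltP 0%R y; last first.
    by apply: eq_integral => b _; rewrite /haar [(0 < y)%R]ltNge y0/= !(mul0r, mulr0).
  rewrite -(@haar_scale (fun b => haar_bump (b / theta y) * haar y * F b)%R
    (theta y)); last 3 first.
  - exact: th0.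
  - apply: measurable_funM => //; apply: measurable_funM => //.
    by apply: (measurableT_comp mb); exact: measurable_funM.
  - by move=> x; rewrite !mulr_ge0.
  apply: eq_integral => b _; congr EFin.
  rewrite (mulrC (theta y)) mulfK ?gt_eqF ?th0//; ring.
(* At fixed [b], the same dilation of [y] as before turns [b / theta y] into [1 / theta y], and the
   two variables separate. *)
have step3 b : \int[leb]_y (haar b * (haar_bump (b / theta y) * haar y * F b))%:E
    = (haar b * F b)%:E * \int[leb]_y (haar y * haar_bump (theta y)^-1)%:E.
  have [b_gt0|b_le0] := ltP 0%R b; last first.
    have -> : haar b = 0%R by rewrite /haar ltNge b_le0.
    rewrite mul0r mul0e; apply: integral0_eq => y _.
    by rewrite mul0r.
  have [t t0 Ht] := Hth b b_gt0.
  rewrite -ge0_integralZl//; last 3 first.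
  - apply/measurable_EFinP; apply: measurable_funM => //.
    by apply: (measurableT_comp mb); exact: (measurableT_comp mi).
  - by move=> x _; rewrite lee_fin mulr_ge0.
  - by rewrite lee_fin mulr_ge0.
  transitivity (\int[leb]_y (haar y * ((haar b * F b) * haar_bump (b / theta y)))%:E).
    by apply: eq_integral => y _; congr EFin; ring.
  rewrite -(@haar_scale (fun y => (haar b * F b) * haar_bump (b / theta y))%R t)//; last 2 first.
  - by apply: measurable_funM => //; exact: mbth.
  - by move=> x; rewrite !mulr_ge0.
  apply: eq_integral => y _; rewrite -EFinM; congr EFin.
  have [y0|y0] := ltP 0%R y; last first.
    by rewrite /haar [(0 < y)%R]ltNge y0/= !(mul0r, mulr0).
  rewrite Ht// invfM mulVKf ?gt_eqF//; ring.
rewrite -[LHS]mul1e -integral_haar_bump -ge0_integralZr//; last 3 first.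
- exact/measurable_EFinP.
- by move=> x _; rewrite lee_fin.
- by apply: integral_ge0 => x _; rewrite lee_fin mulr_ge0.
under eq_integral => b _.
  rewrite -ge0_integralZl//; last 3 first.
  - by apply/measurable_EFinP/measurable_funM => //; exact: mFth.
  - by move=> x _; rewrite lee_fin mulr_ge0.
  - by rewrite lee_fin.
  under eq_integral do rewrite -EFinM.
  rewrite step1.
  over.
have mB : measurable_fun setT (fun p : R * R => p.1 * theta p.2)%R.
  by apply: measurable_funM => //; exact: measurableT_comp.
have mB' : measurable_fun setT (fun p : R * R => p.1 / theta p.2)%R.
  by apply: measurable_funM => //; apply: (measurableT_comp mi); exact: measurableT_comp.
rewrite integral_swap; last 2 first.
- apply: measurable_funM; first exact: (measurableT_comp mhb).
  by apply: measurable_funM; [exact: (measurableT_comp mh)|exact: (measurableT_comp mF)].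
- by move=> x y; rewrite !mulr_ge0.
under eq_integral do rewrite step2.
rewrite -(integral_swap (w := fun b y =>
  (haar b * (haar_bump (b / theta y) * haar y * F b))%R)); last 2 first.
- apply: measurable_funM; first exact: (measurableT_comp mh).
  apply: measurable_funM; last exact: (measurableT_comp mF).
  by apply: measurable_funM; [exact: (measurableT_comp mb)|exact: (measurableT_comp mh)].
- by move=> x y; rewrite !mulr_ge0.
under eq_integral do rewrite step3.
rewrite ge0_integralZr//; last 3 first.
- by apply/measurable_EFinP; exact: measurable_funM.
- by move=> x _; rewrite lee_fin mulr_ge0.
- by apply: integral_ge0 => x _; rewrite lee_fin mulr_ge0.
by rewrite muleC.
Qed.
End LineIntegrals.

(** * The hyperbolic measure *)

Section HyperbolicMeasure.
Variable R : realType.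
Notation leb := (@lebesgue_measure R).
Notation haar := (@haar R).
Local Open Scope ereal_scope.

Let m1 : measurable_fun setT (fst : R * R -> R) := measurable_fst.
Let m2 : measurable_fun setT (snd : R * R -> R) := measurable_snd.
Let mh := @measurable_haar R.
Let mi := @measurable_invr R.
Let h0 := @haar_ge0 R.

Let msqrt : measurable_fun setT (@Num.sqrt R).
Proof. by apply: continuous_measurable_fun; exact: sqrt_continuous. Qed.

Lemma measurable_comp2 (k : R -> R -> R) d (T : measurableType d)
    (f g : T -> R) : measurable_fun setT (fun p : R * R => k p.1 p.2) ->
  measurable_fun setT f -> measurable_fun setT g ->
  measurable_fun setT (fun t => k (f t) (g t)).
Proof.
move=> mk mf mg.
exact: (measurableT_comp mk (measurable_fun_pair mf mg)).
Qed.

Lemma measurable_inner_integral (w : R -> R -> R) :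
  measurable_fun setT (fun p : R * R => w p.1 p.2) ->
  (forall x y, 0 <= w x y)%R ->
  measurable_fun setT (fun x => \int[leb]_y (w x y)%:E).
Proof.
move=> mw w0.
apply: (@measurable_fun_fubini_tonelli_F _ _ _ _ _ leb (fun p : R * R => (w p.1 p.2)%:E)).
  exact/measurable_EFinP.
by move=> p; rewrite lee_fin.
Qed.

(* The integral of [k] against [dx dy / y^2] over the upper half-plane. *)
Definition hyp_integral (k : R -> R -> R) :=
  \int[leb]_x \int[leb]_y (haar y * (haar y * k x y))%:E.

(* [hyp_integral] in the coordinates [x] and [s = x^2 + y^2]. *)
Definition horo_integral (k : R -> R -> R) :=
  \int[leb]_x \int[leb]_s
    (haar (s - x ^+ 2) * (haar (Num.sqrt (s - x ^+ 2)) * k x (Num.sqrt (s - x ^+ 2))))%:E.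

(** At fixed [x], the map [y -> y ^ 2] carries dilations to dilations, so [haar_substitution]
    applies; a translation by [x ^ 2] follows. What matters is that [c] is the same for all [k] (its
    value is 1/2). *)
Lemma hyp_integral_horo : exists c : \bar R, forall k : R -> R -> R,
  measurable_fun setT (fun p : R * R => k p.1 p.2) ->
  (forall x y, 0 <= k x y)%R ->
  hyp_integral k = c * horo_integral k.
Proof.
exists (\int[leb]_y (haar y * haar_bump (y ^+ 2)^-1)%:E) => k mk k0.
have mF x : measurable_fun setT (fun p : R => haar (Num.sqrt p) * k x (Num.sqrt p))%R.
  apply: measurable_funM; first exact: measurableT_comp.
  by apply: measurable_comp2.
have F0 x p : (0 <= haar (Num.sqrt p) * k x (Num.sqrt p))%R by rewrite mulr_ge0.
rewrite /hyp_integral /horo_integral -ge0_integralZl//; last 3 first.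
- apply: (measurable_inner_integral (w := fun x s => haar (s - x ^+ 2) *
    (haar (Num.sqrt (s - x ^+ 2)) * k x (Num.sqrt (s - x ^+ 2))))%R).
  + have mu : measurable_fun setT (fun p : R * R => p.2 - p.1 ^+ 2)%R.
      by apply: measurable_funB => //; exact: measurable_funX.
    apply: measurable_funM; first exact: measurableT_comp.
    have ms := measurableT_comp msqrt mu.
    apply: measurable_funM; first exact: measurableT_comp.
    exact: measurable_comp2.
  + by move=> ? ?; rewrite !mulr_ge0.
- by move=> x _; apply: integral_ge0 => y _; rewrite lee_fin !mulr_ge0.
- by apply: integral_ge0 => y _; rewrite lee_fin !mulr_ge0// haar_bump_ge0.
apply: eq_integral => x _.
have := @haar_substitution R (fun y => y ^+ 2)%R _ _ _ _ (mF x) (F0 x).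
rewrite (@ge0_integral_affine R
  (fun p => (haar p * (haar (Num.sqrt p) * k x (Num.sqrt p)))%:E)
  1 (- x ^+ 2)%R)//; last 2 first.
- by apply/measurable_EFinP/measurable_funM.
- by move=> p; rewrite lee_fin !mulr_ge0.
rewrite normr1 mul1e.
under [in X in _ = _ * X]eq_integral do rewrite mul1r.
move=> <-.
- apply: eq_integral => y _; congr EFin.
  have [y0|y0] := ltP 0%R y; last by rewrite /haar [(0 < y)%R]ltNge y0/= !mul0r.
  by rewrite sqrtr_sqr gtr0_norm.
- exact: measurable_funX.
- by move=> y y0; rewrite exprn_gt0.
- move=> b b0; exists (Num.sqrt b); first by rewrite sqrtr_gt0.
  by move=> y y0; rewrite exprMn sqr_sqrtr// ltW.
Qed.

(** Since $|-1/z|^2=1/s$, the substitution is $x=-st$ at fixed $s$, followed by $s\mapsto1/s$ at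
    fixed $t$. *)
Lemma horo_integral_inversion (k : R -> R -> R) :
  measurable_fun setT (fun p : R * R => k p.1 p.2) ->
  (forall x y, 0 <= k x y)%R ->
  horo_integral k =
  horo_integral (fun x y => k (- x / (x ^+ 2 + y ^+ 2)) (y / (x ^+ 2 + y ^+ 2)))%R.
Proof.
move=> mk k0; rewrite /horo_integral.
(* The density $u^{-3/2}$ with $u=s-x^2=y^2$; it vanishes for $u\le0$, which confines the integral
   to the inside of the parabola. *)
pose q u : R := (haar u * haar (Num.sqrt u))%R.
have q0 u : (0 <= q u)%R by rewrite mulr_ge0.
have qN u : (u <= 0 -> q u = 0)%R by move=> u0; rewrite /q /haar ltNge u0/= mul0r.
have mq : measurable_fun setT q.
  by apply: measurable_funM => //; exact: measurableT_comp.
under eq_integral do under eq_integral do rewrite mulrA -/(q _).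
under [RHS]eq_integral do under eq_integral do rewrite mulrA -/(q _).
rewrite (integral_swap (w := fun x s =>
  (q (s - x ^+ 2) * k x (Num.sqrt (s - x ^+ 2)))%R)); last 2 first.
- have mu : measurable_fun setT (fun p : R * R => p.2 - p.1 ^+ 2)%R.
    by apply: measurable_funB => //; exact: measurable_funX.
  apply: measurable_funM; first exact: measurableT_comp.
  by apply: measurable_comp2 => //; exact: measurableT_comp.
- by move=> x s; rewrite mulr_ge0.
(* The integrand after [x = - s * t]. One factor [s] is the Jacobian, the other compensates the
   [haar s] split off for the substitution in [s]. *)
pose H t s : R := (s ^+ 2 * (q (s - (s * t) ^+ 2) * k (- (s * t)) (Num.sqrt (s - (s * t) ^+ 2))))%R.
have H0 t s : (0 <= H t s)%R by rewrite /H mulr_ge0 ?sqr_ge0// mulr_ge0.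
have mH : measurable_fun setT (fun p : R * R => H p.1 p.2).
  have mst : measurable_fun setT (fun p : R * R => p.2 * p.1)%R by exact: measurable_funM.
  have mu : measurable_fun setT (fun p : R * R => p.2 - (p.2 * p.1) ^+ 2)%R.
    by apply: measurable_funB => //; exact: measurable_funX.
  apply: measurable_funM; first exact: measurable_funX.
  apply: measurable_funM; first exact: (measurableT_comp mq).
  apply: measurable_comp2 => //; last exact: measurableT_comp.
  exact: measurableT_comp.
transitivity (\int[leb]_s \int[leb]_t (haar s * H t s)%:E).
  apply: eq_integral => s _.
  have [s0|s0] := ltP 0%R s; last first.
    rewrite [RHS]integral0_eq; last first.
      by move=> x _; rewrite /haar ltNge s0/= mul0r.
    apply: integral0_eq => x _.
    by rewrite qN ?mul0r// subr_le0 (le_trans s0)// sqr_ge0.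
  rewrite (@ge0_integral_affine R _ (- s) 0)//; last 3 first.
  - by rewrite oppr_eq0 gt_eqF.
  - have mu : measurable_fun setT (fun x : R => s - x ^+ 2)%R.
      by apply: measurable_funB => //; exact: measurable_funX.
    apply/measurable_EFinP/measurable_funM; first exact: measurableT_comp.
    by apply: measurable_comp2 => //; exact: measurableT_comp.
  - by move=> x; rewrite lee_fin mulr_ge0.
  rewrite -ge0_integralZl//; last 2 first.
  - have ms : measurable_fun setT (fun x : R => - s * x + 0)%R.
      by apply: measurable_funD => //; apply: measurable_funM.
    have mu : measurable_fun setT (fun x : R => s - (- s * x + 0) ^+ 2)%R.
      by apply: measurable_funB => //; exact: measurable_funX.
    apply/measurable_EFinP/measurable_funM; first exact: measurableT_comp.
    by apply: measurable_comp2 => //; exact: measurableT_comp.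
  - by move=> x _; rewrite lee_fin mulr_ge0.
  apply: eq_integral => t _; rewrite -EFinM; congr EFin.
  rewrite /H normrN gtr0_norm// addr0 mulNr sqrrN /haar s0.
  by rewrite [RHS]mulrA; congr (_ * _)%R; field; rewrite gt_eqF.
rewrite -(integral_swap (w := fun t s => (haar s * H t s)%R)); last 2 first.
- by apply: measurable_funM => //; exact: measurableT_comp.
- by move=> t s; rewrite mulr_ge0.
apply: eq_integral => t _.
have mHt : measurable_fun setT (H t) by exact: measurable_section.
(* This exhibits [theta = GRing.inv]; here the constant of [haar_substitution] is the mass of
   [haar_bump], namely 1. *)
transitivity (\int[leb]_s (haar s * H t (s^-1)^-1)%:E).
  by apply: eq_integral => s _; rewrite invrK.
rewrite (@haar_substitution R GRing.inv (fun s => H t s^-1)%R)//; last 3 first.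
- by move=> y; rewrite invr_gt0.
- move=> b b0; exists b^-1%R; first by rewrite invr_gt0.
  by move=> y y0; rewrite invfM invrK.
- exact: measurableT_comp.
have -> : \int[leb]_y (haar y * haar_bump (y^-1)^-1)%:E = 1.
  by rewrite -[RHS](integral_haar_bump R); apply: eq_integral => y _; rewrite invrK.
rewrite mul1e.
apply: eq_integral => s _; congr EFin.
have [s0|s0] := ltP 0%R s; last first.
  rewrite qN ?mul0r; last by rewrite subr_le0 (le_trans s0)// sqr_ge0.
  by rewrite /haar ltNge s0/= mul0r.
have [st|st] := ltP 0%R (s - t ^+ 2)%R; last first.
  rewrite [in RHS]qN// /H [q _]qN ?mul0r ?mulr0//.
  have -> : (s^-1 - (s^-1 * t) ^+ 2 = (s - t ^+ 2) / s ^+ 2)%R.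
    by field; rewrite gt_eqF.
  by rewrite pmulr_lle0// invr_gt0 exprn_gt0.
rewrite /H.
have -> : (s^-1 - (s^-1 * t) ^+ 2 = (s - t ^+ 2) / s ^+ 2)%R.
  by field; rewrite gt_eqF.
set u := (s - t ^+ 2)%R in st *.
have -> : Num.sqrt (u / s ^+ 2) = (Num.sqrt u / s)%R.
  by rewrite sqrtrM ?ltW// sqrtrV ?sqr_ge0// sqrtr_sqr gtr0_norm.
rewrite sqr_sqrtr ?ltW//.
have -> : (t ^+ 2 + u = s)%R by rewrite /u addrC subrK.
have su : (0 < Num.sqrt u)%R by rewrite sqrtr_gt0.
rewrite mulNr (mulrC t) !mulrA; congr (_ * _)%R.
rewrite /q /haar s0 st su !divr_gt0 ?exprn_gt0// sqrtrM ?ltW// sqrtrV ?sqr_ge0//.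
rewrite sqrtr_sqr gtr0_norm// divr_gt0//.
by field; rewrite !gt_eqF.
Qed.

Lemma hyp_integral_inversion (k : R -> R -> R) :
  measurable_fun setT (fun p : R * R => k p.1 p.2) ->
  (forall x y, 0 <= k x y)%R ->
  hyp_integral k =
  hyp_integral (fun x y => k (- x / (x ^+ 2 + y ^+ 2)) (y / (x ^+ 2 + y ^+ 2)))%R.
Proof.
move=> mk k0; have [c Hc] := hyp_integral_horo.
pose k' x y := k (- x / (x ^+ 2 + y ^+ 2))%R (y / (x ^+ 2 + y ^+ 2))%R.
have mr : measurable_fun setT (fun p : R * R => p.1 ^+ 2 + p.2 ^+ 2)%R.
  by apply: measurable_funD; exact: measurable_funX.
have mri := measurableT_comp mi mr.
have mk' : measurable_fun setT (fun p : R * R => k' p.1 p.2).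
  apply: (measurable_comp2 (f := fun p : R * R => (- p.1 / (p.1 ^+ 2 + p.2 ^+ 2))%R)
    (g := fun p : R * R => (p.2 / (p.1 ^+ 2 + p.2 ^+ 2))%R) mk).
  - by apply: measurable_funM => //; exact: measurableT_comp.
  - exact: measurable_funM.
have k'0 x y : (0 <= k' x y)%R by exact: k0.
by rewrite (Hc _ mk k0) (horo_integral_inversion mk k0) -(Hc _ mk' k'0).
Qed.

Lemma hyp_integral_shift (k : R -> R -> R) (b : R) :
  measurable_fun setT (fun p : R * R => k p.1 p.2) ->
  (forall x y, 0 <= k x y)%R ->
  hyp_integral k = hyp_integral (fun x y => k (x + b) y)%R.
Proof.
move=> mk k0; rewrite /hyp_integral.
rewrite (@ge0_integral_affine R _ 1 b)//; last 2 first.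
- apply: (measurable_inner_integral (w := fun x y => haar y * (haar y * k x y))%R).
  + apply: measurable_funM; first exact: measurableT_comp.
    by apply: measurable_funM => //; exact: measurableT_comp.
  + by move=> ? ?; rewrite !mulr_ge0.
- by move=> x; apply: integral_ge0 => y _; rewrite lee_fin !mulr_ge0.
rewrite normr1 mul1e; apply: eq_integral => x _.
by rewrite mul1r.
Qed.

Lemma hyp_integral_scale (k : R -> R -> R) (a : R) : (0 < a)%R ->
  measurable_fun setT (fun p : R * R => k p.1 p.2) ->
  (forall x y, 0 <= k x y)%R ->
  hyp_integral k = hyp_integral (fun x y => k (a * x) (a * y))%R.
Proof.
move=> a0 mk k0; rewrite /hyp_integral.
have mw : measurable_fun setT (fun p : R * R => (haar p.2 * (haar p.2 * k p.1 p.2))%R).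
  apply/measurable_funM; first exact: measurableT_comp.
  by apply: measurable_funM => //; exact: measurableT_comp.
have mI : measurable_fun setT (fun x => \int[leb]_y (haar y * (haar y * k x y))%:E).
  apply: measurable_inner_integral; first exact: mw.
  by move=> x y; rewrite !mulr_ge0.
have ma : measurable_fun setT (fun x : R => a * x + 0)%R.
  by apply: measurable_funD => //; apply: measurable_funM.
rewrite (@ge0_integral_affine R _ a 0)//; last 2 first.
- by rewrite gt_eqF.
- by move=> x; apply: integral_ge0 => y _; rewrite lee_fin !mulr_ge0.
rewrite -ge0_integralZl//; last 2 first.
- exact: (measurableT_comp mI ma).
- by move=> x _; apply: integral_ge0 => y _; rewrite lee_fin !mulr_ge0.
apply: eq_integral => x _.
rewrite addr0 -ge0_integralZl//; last 2 first.
- apply/measurable_EFinP.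
  exact: (measurable_section (w := fun x y => haar y * (haar y * k x y))%R mw).
- by move=> y _; rewrite lee_fin !mulr_ge0.
transitivity (\int[leb]_y (haar y * (a * haar y * k (a * x) y))%:E).
  apply: eq_integral => y _; rewrite -EFinM; congr EFin.
  by rewrite gtr0_norm//; ring.
rewrite -(@haar_scale R (fun y => a * haar y * k (a * x) y)%R a)//; last 2 first.
- apply: measurable_funM; first exact: measurable_funM.
  exact: (measurable_section mk).
- by move=> y; rewrite !mulr_ge0// ltW.
apply: eq_integral => y _; congr EFin; congr (_ * (_ * _))%R.
rewrite /haar pmulr_rgt0//; case: ifP => y0; last by rewrite mulr0.
by field; rewrite !gt_eqF.
Qed.
End HyperbolicMeasure.

(** * Moebius transformations *)

Section MatrixTwo.

Lemma det_mx22 (S : comPzRingType) (A : 'M[S]_2) :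
  \det A = A 0 0 * A 1 1 - A 0 1 * A 1 0.
Proof.
rewrite (expand_det_row _ 0) !big_ord_recl big_ord0 addr0.
rewrite /cofactor !det_mx11 !mxE /= expr0 mul1r expr1 mulN1r mulrN.
congr (_ * A _ _ - A _ _ * A _ _); exact: val_inj.
Qed.

Lemma mulmx22 (S : pzRingType) (A B : 'M[S]_2) i j :
  (A * B) i j = A i 0 * B 0 j + A i 1 * B 1 j.
Proof.
rewrite -mulmxE mxE !big_ord_recl big_ord0 addr0.
congr (_ + A _ _ * B _ _); exact: val_inj.
Qed.

Lemma SL2Z_mulVmx (g : 'M[int]_2) : SL2Z g -> invmx g * g = 1.
Proof. by move=> dg; apply: mulVmx; rewrite unitmxE dg unitr1. Qed.

Lemma SL2Z_mulmxV (g : 'M[int]_2) : SL2Z g -> g * invmx g = 1.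
Proof. by move=> dg; apply: mulmxV; rewrite unitmxE dg unitr1. Qed.

Lemma mx22P (S : Type) (A B : 'M[S]_2) :
  A 0 0 = B 0 0 -> A 0 1 = B 0 1 -> A 1 0 = B 1 0 -> A 1 1 = B 1 1 -> A = B.
Proof.
move=> h00 h01 h10 h11; apply/matrixP => i j.
by case: (unliftP 0 i) => [k|] ->; case: (unliftP 0 j) => [l|] ->;
  rewrite ?ord1 //; [move: h11|move: h10|move: h01];
  rewrite (_ : 1 = lift ord0 0) //; exact: val_inj.
Qed.
End MatrixTwo.

Section MobiusPlane.
Variable R : realType.
Implicit Types (g h : 'M[int]_2) (x y : R).

(** This is $|cz+d|^2$ at $z=x+iy$, with $(c,d)$ the bottom row of [g]. [mob_re] and [mob_im] below
    are the coordinates of $gz$ (see [cpx_mobius]), kept real so that they are visibly measurable on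
    [R * R]. *)
Definition mob_den g x y : R :=
  ((g 1 0)%:~R * x + (g 1 1)%:~R) ^+ 2 + ((g 1 0)%:~R * y) ^+ 2.

Definition mob_re g x y : R :=
  (((g 0 0)%:~R * x + (g 0 1)%:~R) * ((g 1 0)%:~R * x + (g 1 1)%:~R)
   + (g 0 0)%:~R * (g 1 0)%:~R * y ^+ 2) / mob_den g x y.

Definition mob_im g x y : R := y / mob_den g x y.

Lemma SL2Z_detR g : SL2Z g ->
  (g 0 0)%:~R * (g 1 1)%:~R - (g 0 1)%:~R * (g 1 0)%:~R = 1 :> R.
Proof. by rewrite /SL2Z/= det_mx22 -!intrM -intrB => ->. Qed.

Lemma mob_den_gt0 g x y : SL2Z g -> 0 < y -> 0 < mob_den g x y.
Proof.
move=> /SL2Z_detR; rewrite /mob_den.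
have [->|c0] := eqVneq ((g 1 0)%:~R : R) 0.
  rewrite !(mul0r, mulr0) add0r subr0 expr0n/= addr0 => H y0.
  rewrite lt_def sqr_ge0 sqrf_eq0 andbT.
  by apply/negP => /eqP d0; move: H; rewrite d0 mulr0 => /eqP; rewrite eq_sym oner_eq0.
move=> _ y0; rewrite ltr_wpDl ?sqr_ge0// lt_def sqr_ge0 sqrf_eq0 andbT.
by rewrite mulf_neq0// gt_eqF.
Qed.

Lemma mob_im_gt0 g x y : SL2Z g -> 0 < y -> 0 < mob_im g x y.
Proof. by move=> dg y0; rewrite divr_gt0// mob_den_gt0. Qed.

(** The squared modulus of the cocycle relation $j(gh,z)=j(g,hz)\,j(h,z)$ for $j(g,z)=cz+d$. *)
Lemma mob_den_mul g h x y : SL2Z g -> SL2Z h -> 0 < y ->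
  mob_den (g * h) x y = mob_den g (mob_re h x y) (mob_im h x y) * mob_den h x y.
Proof.
move=> dg dh y0; have := mob_den_gt0 x dh y0; have := SL2Z_detR dh.
rewrite [mob_den (g * h) _ _]/mob_den [mob_den g _ _]/mob_den /mob_re /mob_im.
rewrite !mulmx22 !rmorphD/= !rmorphM/=.
set D := mob_den h x y => d1 D0.
have DE : D = ((h 1 0)%:~R * x + (h 1 1)%:~R) ^+ 2 + ((h 1 0)%:~R * y) ^+ 2 by [].
move: D DE D0 d1.
move: (h 0 0)%:~R (h 0 1)%:~R (h 1 0)%:~R (h 1 1)%:~R => a b c d.
move: (g 1 0)%:~R (g 1 1)%:~R => c' d'.
move=> D DE D0 d1.
have D1 : D != 0 by rewrite gt_eqF.
apply: (mulIf D1).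
have -> : ((c' * (((a * x + b) * (c * x + d) + a * c * y ^+ 2) / D) + d') ^+ 2
   + (c' * (y / D)) ^+ 2) * D * D =
   (c' * ((a * x + b) * (c * x + d) + a * c * y ^+ 2) + d' * D) ^+ 2 + (c' * y) ^+ 2 by field.
(* With the determinant 1 of [h] inserted, the identity is polynomial in the entries. *)
have -> : (c' * y) ^+ 2 = (c' * y * (a * d - b * c)) ^+ 2 by rewrite d1 mulr1.
rewrite DE; ring.
Qed.

Lemma mob_im_mul g h x y : SL2Z g -> SL2Z h -> 0 < y ->
  mob_im (g * h) x y = mob_im g (mob_re h x y) (mob_im h x y).
Proof.
move=> dg dh y0; rewrite {1}/mob_im mob_den_mul// {3}/mob_im.
rewrite [in RHS]/mob_im; field.
by rewrite !gt_eqF// mob_den_gt0// mob_im_gt0.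
Qed.

Lemma cpx_mobius g x y : SL2Z g -> 0 < y ->
  mobius g (cpx (x, y)) = cpx (mob_re g x y, mob_im g x y).
Proof.
move=> dg y0; rewrite /mobius /cpx/=.
have := mob_den_gt0 x dg y0; have := SL2Z_detR dg.
rewrite -!(rmorph_int (real_complex R)).
rewrite /mob_re /mob_im /mob_den.
move: (g 0 0)%:~R (g 0 1)%:~R (g 1 0)%:~R (g 1 1)%:~R => a b c d.
set D := (_ ^+ 2 + _ ^+ 2) => d1 D0.
have D1 : D != 0 by rewrite gt_eqF.
have den0 : c%:C * (x +i* y) + d%:C != 0 :> R[i].
  apply/negP => /eqP/(congr1 (fun z => complex.Re z ^+ 2 + complex.Im z ^+ 2)).
  rewrite /= !(mul0r, mulr0, subr0, addr0, add0r) expr0n/= addr0 => /eqP.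
  by rewrite -/D gt_eqF.
apply: (mulIf den0); rewrite mulfVK//.
apply/eqP; rewrite eq_complex/= !(mul0r, mulr0, subr0, addr0, add0r).
apply/andP; split; apply/eqP.
  apply: (mulIf D1).
  have -> : (((a * x + b) * (c * x + d) + a * c * y ^+ 2) / D * (c * x + d) -
    y / D * (c * y)) * D = ((a * x + b) * (c * x + d) + a * c * y ^+ 2) * (c * x + d) -
    y * (c * y) * 1 by field.
  rewrite -d1 /D; ring.
apply: (mulIf D1).
have -> : (((a * x + b) * (c * x + d) + a * c * y ^+ 2) / D * (c * y) +
    y / D * (c * x + d)) * D = ((a * x + b) * (c * x + d) + a * c * y ^+ 2) * (c * y) +
    y * (c * x + d) * 1 by field.
rewrite -d1 /D; ring.
Qed.

Lemma mob_re_mul g h x y : SL2Z g -> SL2Z h -> 0 < y ->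
  mob_re (g * h) x y = mob_re g (mob_re h x y) (mob_im h x y).
Proof.
move=> dg dh y0; rewrite {1}/mob_re mob_den_mul//.
have := mob_den_gt0 (mob_re h x y) dg (mob_im_gt0 x dh y0).
have := mob_den_gt0 x dh y0; have := SL2Z_detR dh.
rewrite [mob_re g _ _]/mob_re !mulmx22 !rmorphD/= !rmorphM/=.
set E := mob_den g _ _; rewrite /mob_im /mob_re.
set D := mob_den h x y => d1 D0 E0.
have DE : D = ((h 1 0)%:~R * x + (h 1 1)%:~R) ^+ 2 + ((h 1 0)%:~R * y) ^+ 2 by [].
move: D DE D0 d1 E E0.
move: (h 0 0)%:~R (h 0 1)%:~R (h 1 0)%:~R (h 1 1)%:~R => a b c d.
move: (g 0 0)%:~R (g 0 1)%:~R (g 1 0)%:~R (g 1 1)%:~R => a' b' c' d'.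
move=> D DE D0 d1 E E0.
have D1 : D != 0 by rewrite gt_eqF.
have E1 : E != 0 by rewrite gt_eqF.
have ED1 : E * D ^+ 2 != 0 by rewrite mulf_neq0// expf_neq0.
apply: (mulIf ED1).
set X := (a * x + b) * (c * x + d) + a * c * y ^+ 2.
have -> : ((a' * (X / D) + b') * (c' * (X / D) + d') + a' * c' * (y / D) ^+ 2) / E * (E * D ^+ 2)
  = (a' * X + b' * D) * (c' * X + d' * D) + a' * c' * (y * 1) ^+ 2 by field; rewrite ?D1 ?E1.
rewrite -d1 /X.
transitivity ((((a' * a + b' * c) * x + (a' * b + b' * d)) *
  ((c' * a + d' * c) * x + (c' * b + d' * d)) +
 (a' * a + b' * c) * (c' * a + d' * c) * y ^+ 2) * D); first by field; rewrite ?D1 ?E1.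
rewrite DE; ring.
Qed.

Lemma mob_re1 x y : 0 < y -> mob_re 1 x y = x.
Proof.
move=> y0; rewrite /mob_re /mob_den !mxE/=.
by field; rewrite /= ?mul0r ?add0r ?oner_eq0.
Qed.

Lemma mob_im1 x y : 0 < y -> mob_im 1 x y = y.
Proof.
move=> y0; rewrite /mob_im /mob_den !mxE/=.
by field; rewrite /= ?mul0r ?add0r ?oner_eq0.
Qed.

Lemma measurable_mob_den g :
  measurable_fun setT (fun p : R * R => mob_den g p.1 p.2).
Proof.
apply: measurable_funD; apply: measurable_funX.
  by apply: measurable_funD => //; apply: measurable_funM.
exact: measurable_funM.
Qed.

Lemma measurable_mob_im g :
  measurable_fun setT (fun p : R * R => mob_im g p.1 p.2).
Proof.
apply: measurable_funM => //.
exact: (measurableT_comp (@measurable_invr R) (measurable_mob_den g)).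
Qed.

Lemma measurable_mob_re g :
  measurable_fun setT (fun p : R * R => mob_re g p.1 p.2).
Proof.
apply: measurable_funM; last first.
  exact: (measurableT_comp (@measurable_invr R) (measurable_mob_den g)).
apply: measurable_funD; apply: measurable_funM => //.
- by apply: measurable_funD => //; apply: measurable_funM.
- by apply: measurable_funD => //; apply: measurable_funM.
- exact: measurable_funX.
Qed.

Lemma eq_hyp_integral (k k' : R -> R -> R) :
  (forall x y, 0 < y -> k x y = k' x y) -> hyp_integral k = hyp_integral k'.
Proof.
move=> kk; apply: eq_integral => x _; apply: eq_integral => y _; congr EFin.
have [y0|y0] := ltP 0 y; first by rewrite kk.
by rewrite /haar ltNge y0/= !mul0r.
Qed.

(** If $c\ne0$, then $gz=a/c-1/(c^2(z+d/c))$ is made of translations, a dilation and the inversion.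
    If $c=0$, then $d=1/a$ and $gz=a^2z+ab$. *)
Lemma hyp_integral_mob (k : R -> R -> R) g : SL2Z g ->
  measurable_fun setT (fun p : R * R => k p.1 p.2) ->
  (forall x y, 0 <= k x y) ->
  hyp_integral k = hyp_integral (fun x y => k (mob_re g x y) (mob_im g x y)).
Proof.
move=> dg mk k0; have d1 := SL2Z_detR dg.
have m1 : measurable_fun setT (fst : R * R -> R) by exact: measurable_fst.
have m2 : measurable_fun setT (snd : R * R -> R) by exact: measurable_snd.
have [c0|c0] := eqVneq ((g 1 0)%:~R : R) 0.
  have a0 : (g 0 0)%:~R != 0 :> R.
    by apply/eqP => a0; move: d1; rewrite a0 c0 mul0r mulr0 subr0 => /eqP; rewrite eq_sym oner_eq0.
  have a2 : 0 < (g 0 0)%:~R ^+ 2 :> R by rewrite lt_def sqrf_eq0 a0 sqr_ge0.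
  pose k1 x y := k (x + (g 0 1)%:~R * (g 0 0)%:~R) y.
  have mk1 : measurable_fun setT (fun p : R * R => k1 p.1 p.2).
    apply: (measurable_comp2 (f := fun p : R * R => p.1 + _) mk _ m2).
    exact: measurable_funD.
  have k10 x y : 0 <= k1 x y by exact: k0.
  rewrite (hyp_integral_shift ((g 0 1)%:~R * (g 0 0)%:~R) mk k0).
  rewrite (hyp_integral_scale a2 mk1 k10) /k1.
  apply: eq_hyp_integral => x y y0; move: d1 a0.
  rewrite /mob_re /mob_im /mob_den c0.
  move: (g 0 0)%:~R (g 0 1)%:~R (g 1 1)%:~R => a b d.
  rewrite mulr0 subr0 => d1 a0.
  have -> : d = a^-1 by apply: (mulfI a0); rewrite d1 mulfV.
  by congr k; field; rewrite a0 ?mul0r ?add0r ?oner_eq0.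
have c2 : 0 < (g 1 0)%:~R ^+ 2 :> R by rewrite lt_def sqrf_eq0 c0 sqr_ge0.
set a : R := (g 0 0)%:~R in d1; set b : R := (g 0 1)%:~R in d1.
set c : R := (g 1 0)%:~R in d1 c0 c2; set d : R := (g 1 1)%:~R in d1.
have mr : measurable_fun setT (fun p : R * R => p.1 ^+ 2 + p.2 ^+ 2).
  by apply: measurable_funD; exact: measurable_funX.
have mri := measurableT_comp (@measurable_invr R) mr.
pose k1 x y := k (x + a / c) y.
have mk1 : measurable_fun setT (fun p : R * R => k1 p.1 p.2).
  apply: (measurable_comp2 (f := fun p : R * R => p.1 + a / c) mk _ m2).
  exact: measurable_funD.
have k10 x y : 0 <= k1 x y by exact: k0.
pose k2 x y := k1 (- x / (x ^+ 2 + y ^+ 2)) (y / (x ^+ 2 + y ^+ 2)).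
have mk2 : measurable_fun setT (fun p : R * R => k2 p.1 p.2).
  apply: (measurable_comp2 (f := fun p : R * R => - p.1 / (p.1 ^+ 2 + p.2 ^+ 2))
    (g := fun p : R * R => p.2 / (p.1 ^+ 2 + p.2 ^+ 2)) mk1).
  - by apply: measurable_funM => //; exact: measurableT_comp.
  - exact: measurable_funM.
have k20 x y : 0 <= k2 x y by exact: k0.
pose k3 x y := k2 (c ^+ 2 * x) (c ^+ 2 * y).
have mk3 : measurable_fun setT (fun p : R * R => k3 p.1 p.2).
  by apply: (measurable_comp2 (f := fun p : R * R => c ^+ 2 * p.1)
    (g := fun p : R * R => c ^+ 2 * p.2) mk2); exact: measurable_funM.
have k30 x y : 0 <= k3 x y by exact: k0.
rewrite (hyp_integral_shift (a / c) mk k0) (hyp_integral_inversion mk1 k10).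
rewrite (hyp_integral_scale c2 mk2 k20) (hyp_integral_shift (d / c) mk3 k30).
rewrite /k3 /k2 /k1.
apply: eq_hyp_integral => x y y0.
have D0 := mob_den_gt0 x dg y0; rewrite /mob_re /mob_im.
rewrite -/a -/b -/c -/d; set D := mob_den g x y in D0 *.
have DE : D = (c * x + d) ^+ 2 + (c * y) ^+ 2 by [].
have -> : (c ^+ 2 * (x + d / c)) ^+ 2 + (c ^+ 2 * y) ^+ 2 = c ^+ 2 * D.
  by rewrite DE; field.
have D1 : D != 0 by rewrite gt_eqF.
congr k; last by field; rewrite ?D1 ?c0.
have -> : - (c ^+ 2 * (x + d / c)) / (c ^+ 2 * D) + a / c = (a * D - (c * x + d) * 1) / (c * D).
  by field; rewrite ?D1 ?c0.
rewrite -d1; apply: (mulIf (mulf_neq0 c0 D1)); rewrite divfK ?mulf_neq0//.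
have -> : ((a * x + b) * (c * x + d) + a * c * y ^+ 2) / D * (c * D) =
  ((a * x + b) * (c * x + d) + a * c * y ^+ 2) * c by field.
rewrite DE; ring.
Qed.
End MobiusPlane.

(** * Orbits in a strip *)

Section Counting.
Variable R : realType.

Lemma le_norm_sqr (a r : R) : 0 <= r -> a ^+ 2 <= r ^+ 2 -> `|a| <= r.
Proof. by move=> r0 ar; rewrite ler_norml; apply/andP; split; nra. Qed.

(** The condition is $|cz+d|\le r$. It forces $c=kq$ with $|k|\le r/(qy)$ and puts $d$ in an
    interval of length $2r$ about $-cx$, which holds at most $2r+1\le3r$ integers since $r\ge1$. The
    row $c=0$ supplies only $d=\pm1$, the summand 2. *)
Lemma size_lattice_disc (q : nat) (x y r : R) (s : seq (int * int)) :
  (0 < q)%N -> 0 < y -> 1 <= r -> uniq s ->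
  (forall p, p \in s -> (q %| p.1)%Z /\ (p.1 = 0 -> p.2 \in [:: 1; -1])) ->
  (forall p, p \in s -> (p.1%:~R * x + p.2%:~R) ^+ 2 + (p.1%:~R * y) ^+ 2 <= r ^+ 2) ->
  (size s)%:R <= 2 + 6 * r ^+ 2 / (q%:R * y).
Proof.
move=> q0 y0 r1 us sq sr.
have r0 : 0 < r by exact: lt_le_trans r1.
have qy0 : 0 < q%:R * y by rewrite mulr_gt0// ltr0n.
(* [C] bounds $|k|$, [D] bounds the number of $d$ for one $c$, and [lo c] is the least such $d$; [L]
   lists all the candidates. *)
pose C := Num.truncn (r / (q%:R * y)).
pose D := (Num.truncn (2 * r)).+1.
pose lo (c : int) : int := Num.ceil (- (c%:~R * x) - r).
pose ks : seq int := [seq (k.+1%:Z)%R | k <- iota 0 C] ++ [seq - (k.+1%:Z)%R | k <- iota 0 C].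
pose L : seq (int * int) := [:: (0, 1); (0, -1)] ++
  [seq (k * q%:Z, lo (k * q%:Z) + j%:Z) | k <- ks, j <- iota 0 D].
have sL : {subset s <= L}.
  move=> [c d] ps; have [/dvdzP[k /= ck] c0] := sq _ ps; have /= := sr _ ps.
  have [c00|cn0] := eqVneq c 0.
    move=> _; have /= := c0 c00; rewrite c00 /L mem_cat !inE => /orP[]/eqP ->;
    by rewrite ?eqxx ?orbT.
  move=> H.
  have H1 : `|c%:~R * x + d%:~R| <= r.
    apply: le_norm_sqr; first exact: ltW.
    by apply: le_trans H; rewrite lerDl sqr_ge0.
  have H2 : `|c%:~R * y| <= r.
    apply: le_norm_sqr; first exact: ltW.
    by apply: le_trans H; rewrite lerDr sqr_ge0.
  rewrite /L mem_cat; apply/orP; right; apply/allpairsP.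
  have kn0 : k != 0 by apply: contraNneq cn0 => k0; rewrite ck k0 mul0r.
  have kC : (`|k|%N <= C)%N.
    have rq0 : 0 <= r / (q%:R * y) by rewrite divr_ge0 ?ltW.
    rewrite truncn_ge_nat// ler_pdivlMr//.
    move: H2; rewrite ck normrM (gtr0_norm y0) rmorphM/= normrM.
    by rewrite -intr_norm -mulrA [`|_%:~R|]ger0_norm// ler0n.
  have lod : lo c <= d.
    rewrite /lo ceil_le_int; move: H1; rewrite ler_norml => /andP[]; lra.
  have [j dj] : exists j : nat, d = lo c + j%:Z.
    exists `|d - lo c|%N; rewrite gez0_abs ?subr_ge0//; ring.
  exists (k, j); split; last 2 first.
  - have r20 : 0 <= 2 * r by rewrite mulr_ge0// ltW.
    rewrite mem_iota add0n ltnS truncn_ge_nat//=.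
    have := ceil_ge (- (c%:~R * x) - r); rewrite -/(lo c).
    move: H1; rewrite dj rmorphD/= ler_norml => /andP[].
    rewrite -[j%:~R]/(j%:R : R); lra.
  - by rewrite /= -ck -dj.
  rewrite /= /ks mem_cat; case: (k) kn0 kC => [[//|n]|n] _ kC.
  - by apply/orP; left; apply/mapP; exists n => //; rewrite mem_iota.
  - by apply/orP; right; apply/mapP; exists n; rewrite ?NegzE// mem_iota.
have := uniq_leq_size us sL.
have -> : size L = (2 + (C + C) * D)%N.
  by rewrite size_cat size_allpairs size_cat !size_map !size_iota.
rewrite -(ler_nat R) => /le_trans; apply; rewrite natrD lerD2l natrM natrD.
have C1 : C%:R <= r / (q%:R * y) by rewrite truncn_le divr_ge0 ?ltW.
have D1 : D%:R <= 3 * r.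
  have : (Num.truncn (2 * r))%:R <= 2 * r by rewrite truncn_le mulr_ge0 ?ltW.
  rewrite /D -natr1; lra.
have -> : 6 * r ^+ 2 / (q%:R * y) = (r / (q%:R * y) + r / (q%:R * y)) * (3 * r).
  by field; rewrite gt_eqF//= pnatr_eq0 -lt0n.
by apply: ler_pM => //; rewrite ?addr_ge0// lerD.
Qed.

(** Either [u] or its inverse is [unipotent n] with [0 <= n < w], and minimality of the width leaves
    only [n = 0]. *)
Lemma small_unipotent (G : set 'M[int]_2) (w : nat) (u : 'M[int]_2) :
  is_subgroup G -> is_width G w -> G u -> u 1 0 = 0 -> u 1 1 = 1 ->
  `|u 0 1| < w%:Z -> u = 1.
Proof.
move=> [GS _ _ GV] [_ wmin] Gu u10 u11 uw.
have u00 : u 0 0 = 1.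
  by have := GS _ Gu; rewrite /SL2Z/= det_mx22 u10 u11 mulr0 subr0 mulr1.
have uni (n : nat) : [/\ unipotent n 0 0 = 1, unipotent n 0 1 = n%:Z,
    unipotent n 1 0 = 0 & unipotent n 1 1 = 1].
  by split; rewrite /unipotent !mxE/= ?mulr0 ?mulr1 ?addr0 ?add0r.
have contra (n : nat) : (0 < n)%N -> (n < w)%N -> ~ G (unipotent n).
  move=> n0 nw Gn; have := wmin n (conj n0 (or_introl Gn)).
  by rewrite leqNgt nw.
case u01 : (u 0 1) => [[|n]|n].
- by apply: mx22P; rewrite ?u00 ?u01 ?u10 ?u11 !mxE.
- exfalso; apply: (contra n.+1) => //; first by move: uw; rewrite u01.
  have [e1 e2 e3 e4] := uni n.+1.
  suff -> : unipotent n.+1 = u by [].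
  by apply: mx22P; rewrite ?u00 ?u01 ?u10 ?u11.
- exfalso; apply: (contra n.+1) => //; first by move: uw; rewrite u01.
  have [e1 e2 e3 e4] := uni n.+1.
  suff -> : unipotent n.+1 = invmx u by exact: GV.
  have E : unipotent n.+1 * u = 1.
    apply: mx22P; rewrite mulmx22 ?e1 ?e2 ?e3 ?e4 ?u00 ?u01 ?u10 ?u11 !mxE//=;
    by rewrite ?mulr1 ?mul1r ?mulr0 ?mul0r ?addr0 ?add0r// NegzE addNr.
  have := SL2Z_mulmxV (GS _ Gu) => uV.
  transitivity (unipotent n.+1 * (u * invmx u)); first by rewrite uV mulr1.
  by rewrite mulrA E mul1r.
Qed.

(** Half open in the first coordinate, so that a horizontal shift between two of its points is
    strictly shorter than [w]. *)
Definition strip (w : nat) (Y : R) : set (R * R) :=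
  [set p | 0 < p.1 <= w%:R /\ Y <= p.2].

(* Seen from a point of the orbit lying in the strip, the group elements
   mapping into the strip are told apart by their bottom rows, which are lattice
   points in a disc. *)
Lemma size_orbit_strip (G : set 'M[int]_2) (q w : nat) (Y x y : R)
    (s : seq 'M[int]_2) :
  is_subgroup G -> G `<=` Gamma0 q -> (0 < q)%N -> is_width G w ->
  0 < Y -> 0 < y -> uniq s ->
  (forall g, g \in s -> G g /\ strip w Y (mob_re g x y, mob_im g x y)) ->
  (size s)%:R <= 2 + 6 / (q%:R * Y).
Proof.
move=> sG GG q0 Gw Y0 y0 us Hs.
have [GS _ GM GV] := sG.
case: s us Hs => [|g0 s'] us Hs.
  by rewrite addr_ge0// divr_ge0// mulr_ge0// ltW.
set s := g0 :: s' in us Hs *.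
have [Gg0 [/= g0x g0y]] := Hs g0 (mem_head _ _).
set x0 := mob_re g0 x y in g0x; set y1 := mob_im g0 x y in g0y.
have y10 : 0 < y1 by exact: lt_le_trans g0y.
(* The orbit is viewed from its point [(x0, y1)] in the strip; [h g] carries that point to the image
   of [(x, y)] under [g]. *)
pose h g := g * invmx g0.
have hK g : h g * g0 = g by rewrite /h -mulrA SL2Z_mulVmx ?mulr1//; exact: GS.
have Gh g : g \in s -> G (h g) by move=> /Hs[Gg _]; apply: GM => //; exact: GV.
have hre g : g \in s -> mob_re g x y = mob_re (h g) x0 y1.
  by move=> gs; rewrite -[in LHS](hK g) mob_re_mul//; [exact: (GS _ (Gh _ gs))|exact: GS].
have him g : g \in s -> mob_im g x y = mob_im (h g) x0 y1.
  by move=> gs; rewrite -[in LHS](hK g) mob_im_mul//; [exact: (GS _ (Gh _ gs))|exact: GS].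
pose row g := (h g 1 0, h g 1 1).
(* Equal bottom rows make [u] a horizontal translation between two points of the strip, hence
   trivial by [small_unipotent]. *)
have row_inj : {in s &, injective row}.
  move=> g g' gs gs' [r0 r1].
  have Sh := GS _ (Gh _ gs); have Sh' := GS _ (Gh _ gs').
  pose u := h g' * invmx (h g).
  have uh : u * h g = h g' by rewrite /u -mulrA SL2Z_mulVmx ?mulr1.
  have Gu : G u by apply: GM; [exact: Gh|apply: GV; exact: Gh].
  have Su := GS _ Gu.
  have du : u 0 0 * u 1 1 - u 0 1 * u 1 0 = 1 by rewrite -det_mx22; exact: Su.
  have dh : h g 0 0 * h g 1 1 - h g 0 1 * h g 1 0 = 1 by rewrite -det_mx22; exact: Sh.
  have e10 := mulmx22 u (h g) 1 0; have e11 := mulmx22 u (h g) 1 1.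
  rewrite uh -r0 in e10; rewrite uh -r1 in e11.
  have u10 : u 1 0 = 0.
    transitivity ((u 1 0 * h g 0 0 + u 1 1 * h g 1 0) * h g 1 1 -
      (u 1 0 * h g 0 1 + u 1 1 * h g 1 1) * h g 1 0); last by rewrite -e10 -e11; ring.
    by rewrite -[LHS]mulr1 -dh; ring.
  have u11 : u 1 1 = 1.
    transitivity ((u 1 0 * h g 0 1 + u 1 1 * h g 1 1) * h g 0 0 -
      (u 1 0 * h g 0 0 + u 1 1 * h g 1 0) * h g 0 1).
      by rewrite -[LHS]mulr1 -dh; ring.
    by rewrite -e10 -e11 -dh; ring.
  have u00 : u 0 0 = 1 by move: du; rewrite u10 u11 mulr0 subr0 mulr1.
  have hy : 0 < mob_im (h g) x0 y1 by exact: mob_im_gt0.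
  have shift : mob_re (h g') x0 y1 = mob_re (h g) x0 y1 + (u 0 1)%:~R.
    rewrite -uh mob_re_mul//.
    rewrite {1}/mob_re /mob_den u00 u10 u11 !mul0r !mul1r !add0r.
    by rewrite expr0n/= addr0 expr1n divr1 mulr1 mul0r addr0.
  have [_ [/= /andP[a1 a2] _]] := Hs _ gs; have [_ [/= /andP[b1 b2] _]] := Hs _ gs'.
  rewrite !hre// in a1 a2 b1 b2.
  have u1 : u = 1.
    apply: (small_unipotent sG Gw Gu u10 u11).
    rewrite -(ltr_int R) intr_norm; rewrite shift in b1 b2.
    rewrite -[w%:~R]/(w%:R : R) ltr_norml; apply/andP; split; lra.
  by rewrite -(hK g) -(hK g') -uh u1 mul1r.
have ur : uniq (map row s) by rewrite map_inj_in_uniq.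
(* The image under [h g] has height $y_1/|cz+d|^2$, so lying above $Y$ means $|cz+d|^2\le
   y_1/Y=r^2$. As $y_1\ge Y$, one has $r\ge1$, and $y_1$ cancels in $r^2/(qy_1)=1/(qY)$. *)
pose r := Num.sqrt (y1 / Y).
have r2 : r ^+ 2 = y1 / Y by rewrite sqr_sqrtr// divr_ge0// ltW.
have r1 : 1 <= r.
  have yY : 1 <= y1 / Y by rewrite ler_pdivlMr// mul1r.
  by rewrite -sqrtr1 ler_wsqrtr.
have := @size_lattice_disc q x0 y1 r (map row s) q0 y10 r1 ur.
rewrite size_map r2.
have -> : 6 * (y1 / Y) / (q%:R * y1) = 6 / (q%:R * Y).
  by field; rewrite pnatr_eq0 -lt0n q0 !gt_eqF.
apply.
- move=> _ /mapP[g gs ->] /=; split; first exact: (GG _ (Gh _ gs)).2.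
  move=> c0; have : h g 0 0 * h g 1 1 = 1.
    by have := GS _ (Gh _ gs); rewrite /SL2Z/= det_mx22 c0 mulr0 subr0.
  by move=> /intUnitRing.unitzPl; rewrite !inE.
- move=> _ /mapP[g gs ->] /=.
  have [_ [_ /=]] := Hs _ gs; rewrite him//.
  have D0 := mob_den_gt0 x0 (GS _ (Gh _ gs)) y10.
  rewrite /mob_im => Yle.
  by rewrite ler_pdivlMr// mulrC -ler_pdivlMr.
Qed.
End Counting.

(** * Unfolding *)

Section Unfolding.
Variable R : realType.
Local Notation mu := (@plane_measure R).

Definition hyp_density (k : R -> R -> R) (p : R * R) : R :=
  haar p.2 * (haar p.2 * k p.1 p.2).

Lemma measurable_hyp_density (k : R -> R -> R) :
  measurable_fun setT (fun p : R * R => k p.1 p.2) ->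
  measurable_fun setT (hyp_density k).
Proof.
move=> mk; have mh := @measurable_haar R.
apply: measurable_funM; first exact: (measurableT_comp mh).
by apply: measurable_funM => //; exact: (measurableT_comp mh).
Qed.

Lemma hyp_integral_plane (k : R -> R -> R) :
  measurable_fun setT (fun p : R * R => k p.1 p.2) ->
  (forall x y, 0 <= k x y) ->
  hyp_integral k = (\int[mu]_p (hyp_density k p)%:E)%E.
Proof.
move=> mk k0; rewrite /hyp_integral.
rewrite -(integral_plane (w := fun x y => haar y * (haar y * k x y)))//.
- exact: (measurable_hyp_density mk).
- by move=> x y; rewrite !mulr_ge0// haar_ge0.
Qed.

(** Some $g\in G$ moves a given $z$ into $F$, so $1_T(z)\le\sum_g1_T(z)1_F(gz)$. By invariance of
    the measure and of [phi], integrating the sum gives the integral over $F$ of [phi] times the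
    number of $g$ with $g^{-1}z\in T$, at most [M]. *)
Lemma hyp_integral_unfold_le (G : set 'M[int]_2) (F : set R[i])
    (T : set (R * R)) (phi : R -> R -> R) (M : R) :
  is_subgroup G -> fundamental_domain G F ->
  measurable (T : set (measurableTypeR R * measurableTypeR R)) ->
  measurable_fun setT (fun p : R * R => phi p.1 p.2) ->
  (forall x y, 0 <= phi x y) ->
  (forall g x y, G g -> 0 < y -> phi (mob_re g x y) (mob_im g x y) = phi x y) ->
  0 <= M ->
  (forall x y (s : seq 'M[int]_2), 0 < y -> uniq s ->
    (forall g, g \in s -> G g /\ T (mob_re g x y, mob_im g x y)) ->
    (size s)%:R <= M) ->
  (hyp_integral (fun x y => \1_T (x, y) * phi x y)%R <=
   M%:E * hyp_integral (fun x y => \1_(@cpx R @^-1` F) (x, y) * phi x y)%R)%E.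
Proof.
move=> [GS G1 GM GV] [mF FH Frep] mT mphi phi0 phiG M0 Mle.
set E := @cpx R @^-1` F.
have mIT : measurable_fun setT (fun p : R * R => \1_T (p.1, p.2) : R).
  by under eq_fun do rewrite -surjective_pairing; exact: measurable_indic.
have mIE : measurable_fun setT (fun p : R * R => \1_E (p.1, p.2) : R).
  by under eq_fun do rewrite -surjective_pairing; exact: measurable_indic.
have mob_comp (k : R -> R -> R) g : measurable_fun setT (fun p : R * R => k p.1 p.2) ->
    measurable_fun setT (fun p : R * R => k (mob_re g p.1 p.2) (mob_im g p.1 p.2)).
  move=> mk; apply: measurable_comp2 => //.
  - exact: measurable_mob_re.
  - exact: measurable_mob_im.
(* On the upper half-plane [t g] is [t' g] composed with the action of [g], so the two have the same
   integral. *)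
pose t g x y : R := \1_T (x, y) * (\1_E (mob_re g x y, mob_im g x y) * phi x y).
pose t' g x y : R := \1_T (mob_re (invmx g) x y, mob_im (invmx g) x y) *
  (\1_E (x, y) * phi x y).
(* The sum over [G] becomes a series over the codes of integer matrices; a number that codes no
   element of [G] contributes 0. *)
pose pickG n : option 'M[int]_2 :=
  if pickle_inv n is Some g then if `[< G g >] then Some g else None else None.
pose u n x y : R := oapp (fun g => t g x y) 0 (pickG n).
pose u' n x y : R := oapp (fun g => t' g x y) 0 (pickG n).
have t0 g x y : 0 <= t g x y by rewrite /t !mulr_ge0// indicE.
have t'0 g x y : 0 <= t' g x y by rewrite /t' !mulr_ge0// indicE.
have u0 n x y : 0 <= u n x y by rewrite /u; case: (pickG n) => /=.
have u'0 n x y : 0 <= u' n x y by rewrite /u'; case: (pickG n) => /=.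
have mt g : measurable_fun setT (fun p : R * R => t g p.1 p.2).
  apply: measurable_funM => //; apply: measurable_funM => //.
  exact: (mob_comp (fun x y => \1_E (x, y))).
have mt' g : measurable_fun setT (fun p : R * R => t' g p.1 p.2).
  apply: measurable_funM; last exact: measurable_funM.
  exact: (mob_comp (fun x y => \1_T (x, y))).
have mu_ n : measurable_fun setT (fun p : R * R => u n p.1 p.2).
  by rewrite /u; case: (pickG n) => [g|] /=; [exact: mt|exact: measurable_cst].
have mu'_ n : measurable_fun setT (fun p : R * R => u' n p.1 p.2).
  by rewrite /u'; case: (pickG n) => [g|] /=; [exact: mt'|exact: measurable_cst].
have mhu n := measurable_hyp_density (mu_ n).
have mhu' n := measurable_hyp_density (mu'_ n).
have uu' n : hyp_integral (u n) = hyp_integral (u' n).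
  rewrite /u /u'; case En : (pickG n) => [g|//] /=.
  have Gg : G g.
    by move: En; rewrite /pickG; case: pickle_inv => // h; case: asboolP => // Gh [<-].
  rewrite [RHS](hyp_integral_mob (GS _ Gg) (mt' g) (t'0 g)).
  apply: eq_hyp_integral => x y y0; rewrite /t /t' phiG//.
  have Sg := GS _ Gg; have SV := GS _ (GV _ Gg).
  by rewrite -mob_re_mul// -mob_im_mul// SL2Z_mulVmx// mob_re1// mob_im1.
have mM : measurable_fun setT (fun p : R * R => \1_E (p.1, p.2) * phi p.1 p.2).
  exact: measurable_funM.
have dge0 (k : R -> R -> R) p : (forall x y, 0 <= k x y) -> 0 <= hyp_density k p.
  by move=> k0; rewrite /hyp_density !mulr_ge0// haar_ge0.
rewrite !hyp_integral_plane//; last 3 first.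
- by move=> x y; rewrite mulr_ge0// indicE.
- exact: measurable_funM.
- by move=> x y; rewrite mulr_ge0// indicE.
apply: (@le_trans _ _ (\int[mu]_p (\sum_(n <oo) (hyp_density (u n) p)%:E))%E).
  apply: ge0_le_integral => //.
  - by move=> p _; rewrite lee_fin dge0// => x y; rewrite mulr_ge0// indicE.
  - apply/measurable_EFinP.
    apply: (measurable_hyp_density (k := fun x y => \1_T (x, y) * phi x y)).
    exact: measurable_funM.
  - apply: ge0_emeasurable_sum => [n p _ _|n _].
      by rewrite lee_fin dge0.
    by apply/measurable_EFinP; exact: mhu.
  - move=> [x y] _.
    have [y0|y0] := ltP 0 y; last first.
      rewrite {1}/hyp_density /haar/= ltNge y0/= mul0r.
      by apply: nneseries_ge0 => n _ _; rewrite lee_fin dge0.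
    (* The term of the element moving the point into [F] already equals the left-hand side; the
       series is bounded below by the partial sum ending with it. *)
    have [w [[Fw [g Gg wE]] _]] := Frep (cpx (x, y)) y0.
    rewrite cpx_mobius// in wE; last exact: GS.
    apply: le_trans (@nneseries_lim_ge R (fun n => (hyp_density (u n) (x, y))%:E)
      xpredT 0 (pickle g).+1 _); last first.
      by move=> n _ _; rewrite lee_fin dge0.
    rewrite big_nat_recr//= -[leLHS]add0e leeD//.
      by apply: sume_ge0 => n _; rewrite lee_fin dge0.
    rewrite lee_fin /hyp_density/= /u /pickG pickleK_inv asboolT//= /t.
    by rewrite [\1_E _]indicE mem_set ?mul1r// /E/= -wE.
rewrite integral_nneseries//; last 2 first.
- by move=> n; apply/measurable_EFinP; exact: mhu.
- by move=> n p _; rewrite lee_fin dge0.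
under eq_eseriesr do rewrite -hyp_integral_plane// uu' hyp_integral_plane//.
rewrite -integral_nneseries//; last 2 first.
- by move=> n; apply/measurable_EFinP; exact: mhu'.
- by move=> n p _; rewrite lee_fin dge0.
rewrite -ge0_integralZl//; last 2 first.
- apply/measurable_EFinP.
  exact: (measurable_hyp_density (k := fun x y => \1_E (x, y) * phi x y)).
- by move=> p _; rewrite lee_fin dge0// => x y; rewrite mulr_ge0// indicE.
apply: ge0_le_integral => //.
- by move=> p _; apply: nneseries_ge0 => n _ _; rewrite lee_fin dge0.
- apply: ge0_emeasurable_sum => [n p _ _|n _].
    by rewrite lee_fin dge0.
  by apply/measurable_EFinP; exact: mhu'.
- apply/measurable_EFinP/measurable_funM => //.
  exact: (measurable_hyp_density (k := fun x y => \1_E (x, y) * phi x y)).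
move=> [x y] _.
have [y0|y0] := ltP 0 y; last first.
  rewrite eseries0 => [|n _ _]; last by rewrite /hyp_density /haar/= ltNge y0/= mul0r.
  by rewrite lee_fin mulr_ge0// dge0// => a b; rewrite mulr_ge0// indicE.
apply: lime_le.
  by apply: is_cvg_nneseries => n _ _; rewrite lee_fin dge0.
apply: nearW => N; rewrite sumEFin lee_fin.
(* A partial sum is the density on the right times the number of coded [g] whose inverse moves
   [(x, y)] into [T]; the bound [M] is applied to the list of these inverses. *)
pose P g := `[< T (mob_re (invmx g) x y, mob_im (invmx g) x y) >].
pose gs (l : seq nat) := [seq g <- pmap pickG l | P g].
have sumE l : \sum_(n <- l) hyp_density (u' n) (x, y) =
    (size (gs l))%:R * hyp_density (fun x y => \1_E (x, y) * phi x y) (x, y).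
  elim: l => [|n l IH]; first by rewrite big_nil mul0r.
  rewrite big_cons IH /gs /= /u'; case: (pickG n) => [g|] /=; last first.
    by rewrite /hyp_density/= !mulr0 add0r.
  rewrite /hyp_density/= /t' indicE /P.
  case: asboolP => [Tg|nTg].
    by rewrite mem_set//= mul1r -natr1 mulrDl mul1r addrC.
  by rewrite memNset//= mul0r !mulr0 add0r.
rewrite sumE ler_wpM2r ?dge0// => [a b|]; first by rewrite mulr_ge0// indicE.
rewrite -(size_map (@invmx _ _)); apply: (Mle x y) => //.
  rewrite map_inj_uniq; last exact: can_inj (@invmxK _ _).
  apply: filter_uniq; apply: (@pmap_uniq _ _ _ (@pickle _)); last exact: iota_uniq.
  move=> n; rewrite /pickG; case Ep : (pickle_inv n) => [g|//] /=.
  by case: ifP => //= _; have := @pickle_invK 'M[int]_2 n; rewrite Ep.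
move=> _ /mapP[g + ->]; rewrite mem_filter mem_pmap => /andP[/asboolP Tg /mapP[n _ En]].
split=> //; apply: GV.
by move: En; rewrite /pickG; case: pickle_inv => // h; case: asboolP => // Gh [->].
Qed.
End Unfolding.

(** * Trigonometric sums *)

Section MeanValues.
Variable R : realType.
Local Notation leb := (@lebesgue_measure R).

(* [h] has mean value [m] on [0, w], as witnessed by a primitive. *)
Definition has_mean (w : R) (h : R -> R) (m : R) : Prop :=
  continuous h /\
  exists H : R -> R, (forall x : R, is_derive x (1 : R) H (h x)) /\ H w - H 0 = m * w.

Lemma has_meanD w h h' m m' : has_mean w h m -> has_mean w h' m' ->
  has_mean w (fun x => h x + h' x) (m + m').
Proof.
move=> [ch [H [dH eH]]] [ch' [H' [dH' eH']]]; split.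
  by move=> x; apply: continuousD; [exact: ch|exact: ch'].
exists (fun x => H x + H' x); split; last by rewrite mulrDl -eH -eH'; ring.
by move=> x; have := is_deriveD (dH x) (dH' x).
Qed.

Lemma has_meanZ w h m a : has_mean w h m -> has_mean w (fun x => a * h x) (a * m).
Proof.
move=> [ch [H [dH eH]]]; split.
  by move=> x; apply: continuousM; [exact: cvg_cst|exact: ch].
exists (fun x => a * H x); split; last by rewrite -mulrA -eH; ring.
by move=> x; have := is_deriveZ a (dH x).
Qed.

Lemma has_mean_cst w a : has_mean w (fun=> a) a.
Proof.
split; first by move=> x; exact: cvg_cst.
exists (fun x => a * x); split; last by rewrite mulr0 subr0.
by move=> x; have := is_deriveZ a (is_derive_id x 1); rewrite [_ *: _]mulr1.
Qed.

Lemma has_mean_sum w (I : Type) (r : seq I) (P : pred I) (h : I -> R -> R) (m : I -> R) :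
  (forall i, has_mean w (h i) (m i)) ->
  has_mean w (fun x => \sum_(i <- r | P i) h i x) (\sum_(i <- r | P i) m i).
Proof.
move=> hm; elim: r => [|i r IH].
  by under eq_fun do rewrite big_nil; rewrite big_nil; exact: has_mean_cst.
under eq_fun do rewrite big_cons; rewrite big_cons.
by case: (P i) => //; apply: has_meanD.
Qed.

Lemma continuous_linear_comp (f : R -> R) (k : R) : continuous f ->
  continuous (fun x => f (k * x)).
Proof.
move=> cf x; apply: (@continuous_comp _ _ _ (fun x => k * x) f).
  by apply: continuousM; [exact: cvg_cst|exact: cvg_id].
exact: cf.
Qed.

Lemma is_derive_linear_comp (f df : R -> R) (k x : R) :
  (forall y : R, is_derive y (1 : R) f (df y)) ->
  is_derive x (1 : R) (fun x => f (k * x)) (k * df (k * x)).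
Proof.
move=> df'.
have d1 : is_derive x (1 : R) (fun x : R => k * x) k.
  by have := is_deriveZ k (is_derive_id x 1); rewrite [_ *: _]mulr1.
have := @is_derive1_comp R f (fun x : R => k * x) x _ _ (df' (k * x)) d1.
by rewrite mulrC.
Qed.

Lemma has_mean_cos w k : k != 0 -> sin (k * w) = 0 ->
  has_mean w (fun x => cos (k * x)) 0.
Proof.
move=> k0 skw; split; first by apply: continuous_linear_comp; exact: continuous_cos.
exists (fun x => k^-1 * sin (k * x)); split; last first.
  by rewrite skw !mulr0 sin0 mulr0 subr0 mul0r.
move=> x; have := is_deriveZ k^-1
  (@is_derive_linear_comp (@sin R) _ k x (fun y => is_derive_sin y)).
by rewrite [_ *: _]mulrA mulVf// mul1r.
Qed.

Lemma has_mean_sin w k : k != 0 -> cos (k * w) = 1 ->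
  has_mean w (fun x => sin (k * x)) 0.
Proof.
move=> k0 ckw; split; first by apply: continuous_linear_comp; exact: continuous_sin.
exists (fun x => - k^-1 * cos (k * x)); split; last first.
  by rewrite ckw !mulr0 cos0 mul0r subrr.
move=> x; have := is_deriveZ (- k^-1)
  (@is_derive_linear_comp (@cos R) _ k x (fun y => is_derive_cos y)).
by rewrite [_ *: _]mulrA mulNr mulVf// mulN1r opprK.
Qed.

Lemma cos_2pin n : cos (2 * pi * n%:R) = 1 :> R.
Proof.
by rewrite mulr_natl mulr_natr -[_ *+ n]add0r (periodicn (@cosD2pi R)) cos0.
Qed.

Lemma sin_2pin n : sin (2 * pi * n%:R) = 0 :> R.
Proof.
by rewrite mulr_natl mulr_natr -[_ *+ n]add0r (periodicn (@sinD2pi R)) sin0.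
Qed.

Lemma integral_has_mean (w : R) (h : R -> R) (m : R) : 0 < w -> has_mean w h m ->
  (\int[leb]_(x in `[0%R, w]) (h x)%:E = (m * w)%:E)%E.
Proof.
move=> w0 [ch [H [dH eH]]].
have cH : continuous H.
  by move=> x; apply/differentiable_continuous/derivable1_diffP; have [] := dH x.
rewrite (@continuous_FTC2 R h H 0 w w0) -?EFinB ?eH//.
- exact: continuous_subspaceT.
- split.
  + by move=> x _; have [] := dH x.
  + exact/cvg_at_right_filter/cH.
  + exact/cvg_at_left_filter/cH.
- by move=> x _; rewrite derive1E; have [_ ->] := dH x.
Qed.

Lemma integral_expR_ray (c Y : R) : 0 < c ->
  (\int[leb]_(y in `[Y, +oo[) (expR (- (c * y)))%:E = (expR (- (c * Y)) / c)%:E)%E.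
Proof.
move=> c0.
have dF (x : R) : is_derive x (1 : R) (fun y : R => - c^-1 * expR (- c * y)) (expR (- (c * x))).
  have := is_deriveZ (- c^-1)
    (@is_derive_linear_comp (@expR R) _ (- c) x (fun y => is_derive_expR y)).
  by rewrite [_ *: _]mulrA mulrNN mulVf ?gt_eqF// mul1r mulNr.
have cF : continuous (fun y => - c^-1 * expR (- c * y)).
  by move=> x; apply/differentiable_continuous/derivable1_diffP; have [] := dF x.
rewrite (@ge0_continuous_FTC2y R _ (fun y => - c^-1 * expR (- c * y)) Y 0).
- by rewrite -EFinB sub0r mulNr opprK mulrC mulNr.
- by move=> x _; exact: expR_ge0.
- apply: continuous_subspaceT; under eq_fun do rewrite -mulNr.
  by apply: continuous_linear_comp; exact: continuous_expR.
- rewrite -[X in _ --> X](mulr0 (- c^-1)); apply: cvgM; first exact: cvg_cst.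
  under eq_fun do rewrite mulNr.
  apply: (cvg_comp _ _ _ (@cvgr_expR R)).
  exact: (gt0_cvgMry c0 cvg_id).
- by move=> x _; have [] := dF x.
- exact/cvg_at_right_filter/cF.
- by move=> x _; rewrite derive1E; have [_ ->] := dF x.
Qed.
End MeanValues.

(** * Fourier expansions *)

Section Bessel.
Variable R : realType.
Local Notation leb := (@lebesgue_measure R).
Variables (w : nat) (f : R[i] -> R[i]) (b : nat -> R[i]).
Hypothesis w0 : (0 < w)%N.

Lemma normc_sqr (z : R[i]) : normc z ^+ 2 = complex.Re z ^+ 2 + complex.Im z ^+ 2.
Proof. by case: z => x y /=; rewrite sqr_sqrtr// addr_ge0// sqr_ge0. Qed.

Lemma normc_ge0 (z : R[i]) : 0 <= normc z.
Proof. by case: z => x y /=; rewrite sqrtr_ge0. Qed.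

Lemma Re_sum (I : Type) (r : seq I) (P : pred I) (F : I -> R[i]) :
  complex.Re (\sum_(i <- r | P i) F i) = \sum_(i <- r | P i) complex.Re (F i).
Proof. by apply: (big_morph (@complex.Re R)) => // -[? ?] [? ?]. Qed.

Lemma Im_sum (I : Type) (r : seq I) (P : pred I) (F : I -> R[i]) :
  complex.Im (\sum_(i <- r | P i) F i) = \sum_(i <- r | P i) complex.Im (F i).
Proof. by apply: (big_morph (@complex.Im R)) => // -[? ?] [? ?]. Qed.

Definition freq (n : nat) : R := 2 * pi * n%:R / w%:R.

Definition fterm (n : nat) (x y : R) : R[i] := b n * e (n%:R * cpx (x, y) / w%:R).

Definition fsum (N : nat) (x y : R) : R[i] := \sum_(1 <= n < N.+1) fterm n x y.

Lemma e_cpx n x y : e (n%:R * cpx (x, y) / w%:R) =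
  (expR (- (freq n * y)))%:C * (cos (freq n * x) +i* sin (freq n * x)).
Proof.
have -> : n%:R * cpx (x, y) / w%:R = (n%:R / w%:R * x) +i* (n%:R / w%:R * y) :> R[i].
  rewrite -[in LHS](rmorph_nat (real_complex R) n) -[in LHS](rmorph_nat (real_complex R) w).
  rewrite mulrAC -fmorphV -rmorphM/= /cpx/=.
  by apply/eqP; rewrite eq_complex/= !mul0r subr0 addr0 !eqxx.
rewrite /e /cexp /= !(mul0r, mulr0, mulr1, subr0, addr0, add0r, sub0r).
have -> : 2 * pi * (n%:R / w%:R * y) = freq n * y by rewrite /freq !mulrA.
have -> : 2 * pi * (n%:R / w%:R * x) = freq n * x by rewrite /freq !mulrA.
by rewrite oppr0 !mul0r !add0r.
Qed.

Lemma Re_fterm n x y : complex.Re (fterm n x y) = expR (- (freq n * y)) *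
  (complex.Re (b n) * cos (freq n * x) - complex.Im (b n) * sin (freq n * x)).
Proof.
by rewrite /fterm e_cpx; case: (b n) => u v /=; rewrite !(mul0r, subr0, addr0); ring.
Qed.

Lemma Im_fterm n x y : complex.Im (fterm n x y) = expR (- (freq n * y)) *
  (complex.Re (b n) * sin (freq n * x) + complex.Im (b n) * cos (freq n * x)).
Proof.
by rewrite /fterm e_cpx; case: (b n) => u v /=; rewrite !(mul0r, subr0, addr0); ring.
Qed.

Lemma normc_fterm n x y : normc (fterm n x y) = normc (b n) * expR (- (freq n * y)).
Proof.
rewrite /fterm e_cpx !normcM; congr (_ * _).
rewrite /= cos2Dsin2 sqrtr1 mulr1 expr0n/= addr0 sqrtr_sqr.
by rewrite ger0_norm// expR_ge0.
Qed.

(** Parseval for a finite sum: in the expanded square, terms with $m\ne n$ oscillate with a nonzero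
    multiple of $2\pi/w$ as frequency and have mean 0 over a period. *)
Lemma has_mean_fsum N y :
  has_mean w%:R (fun x => normc (fsum N x y) ^+ 2)
    (\sum_(1 <= n < N.+1) normc (b n) ^+ 2 * expR (- (2 * freq n * y))).
Proof.
pose u n := complex.Re (b n); pose v n := complex.Im (b n).
pose r n := expR (- (freq n * y)).
(* [A] and [- B] are the real and imaginary parts of $b_m\overline{b_n}$, times the decay at height
   [y]. *)
pose A m n := r m * r n * (u m * u n + v m * v n).
pose B m n := r m * r n * (u m * v n - v m * u n).
have wR : w%:R != 0 :> R by rewrite pnatr_eq0 -lt0n.
have E x : normc (fsum N x y) ^+ 2 = \sum_(m < N) \sum_(n < N)
    (A m.+1 n.+1 * cos ((freq m.+1 - freq n.+1) * x) +
     B m.+1 n.+1 * sin ((freq m.+1 - freq n.+1) * x)).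
  rewrite normc_sqr /fsum big_add1 big_mkord Re_sum Im_sum !expr2 !big_distrlr -big_split/=.
  apply: eq_bigr => m _; rewrite -big_split/=; apply: eq_bigr => n _.
  rewrite !Re_fterm !Im_fterm mulrBl cosB sinB /A /B /r /u /v; ring.
rewrite (_ : (fun x => _) = (fun x => \sum_(m < N) \sum_(n < N)
    (A m.+1 n.+1 * cos ((freq m.+1 - freq n.+1) * x) +
     B m.+1 n.+1 * sin ((freq m.+1 - freq n.+1) * x)))); last exact/funext.
rewrite (_ : \sum_(1 <= n < N.+1) _ = \sum_(m < N) \sum_(n < N)
    (if n == m then A m.+1 m.+1 else 0)); last first.
  rewrite big_add1 big_mkord; apply: eq_bigr => m _.
  rewrite -big_mkcond big_pred1_eq /A /r normc_sqr -expRD -/(u _) -/(v _).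
  rewrite mulrC !expr2; congr (expR _ * _); ring.
apply: has_mean_sum => m; apply: has_mean_sum => n.
have [->|nm] := eqVneq n m.
  under eq_fun do rewrite subrr mul0r cos0 sin0 mulr0 addr0 mulr1.
  exact: has_mean_cst.
have k0 : freq m.+1 - freq n.+1 != 0.
  have mn : m.+1%:R - n.+1%:R != 0 :> R by rewrite subr_eq0 eqr_nat eqSS eq_sym.
  rewrite /freq -mulrBl -mulrBr; apply: mulf_neq0; last by rewrite invr_eq0.
  by apply: mulf_neq0 => //; rewrite mulf_neq0 ?pnatr_eq0// gt_eqF// pi_gt0.
have kw : (freq m.+1 - freq n.+1) * w%:R = 2 * pi * m.+1%:R - 2 * pi * n.+1%:R.
  by rewrite /freq -mulrBl mulfVK.
rewrite -[X in has_mean _ _ X](addr0 0) -{1}[X in has_mean _ _ (X + _)](mulr0 (A m.+1 n.+1)).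
rewrite -[X in has_mean _ _ (_ + X)](mulr0 (B m.+1 n.+1)).
apply: has_meanD; apply: has_meanZ.
- by apply: has_mean_cos => //; rewrite kw sinB !sin_2pin mul0r mulr0 subr0.
- by apply: has_mean_sin => //; rewrite kw cosB !sin_2pin !cos_2pin mulr1 mul0r addr0.
Qed.

Hypothesis fb : fourier_expansion w f b.

Lemma fsum_near x y : 0 < y -> forall eps : R, 0 < eps ->
  \forall N \near \oo, normc (f (cpx (x, y)) - fsum N x y) < eps.
Proof.
move=> y0 eps eps0; have /cvgrPdist_lt/(_ eps%:C) := @fb (cpx (x, y)) y0.
rewrite ltcR => /(_ eps0); apply: filterS => N.
by rewrite /fsum /fterm -ltcR; apply.
Qed.

Lemma cvg_Re_fsum x y : 0 < y ->
  complex.Re (fsum N x y) @[N --> \oo] --> complex.Re (f (cpx (x, y))).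
Proof.
move=> y0; apply/cvgrPdist_lt => eps eps0.
apply: filterS (fsum_near x y0 eps0) => N; apply: le_lt_trans.
move: (f _) (fsum _ _ _) => [a c] [a' c'] /=.
by rewrite -sqrtr_sqr ler_wsqrtr// lerDl sqr_ge0.
Qed.

Lemma cvg_Im_fsum x y : 0 < y ->
  complex.Im (fsum N x y) @[N --> \oo] --> complex.Im (f (cpx (x, y))).
Proof.
move=> y0; apply/cvgrPdist_lt => eps eps0.
apply: filterS (fsum_near x y0 eps0) => N; apply: le_lt_trans.
move: (f _) (fsum _ _ _) => [a c] [a' c'] /=.
by rewrite -sqrtr_sqr ler_wsqrtr// lerDr sqr_ge0.
Qed.

(** This supplies the domination for the limit under the integral. Convergence at the single point
    $iy/2$ bounds the terms there; going up to height $y$ multiplies the $n$-th one by $\rho^n$ with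
    $\rho<1$, and its modulus does not depend on $x$. *)
Lemma fsum_bounded y : 0 < y -> exists C : R, forall N x, normc (fsum N x y) <= C.
Proof.
move=> y0; have y20 : 0 < y / 2 by rewrite divr_gt0.
have [N0 _ HN0] := fsum_near 0 y20 ltr01.
pose t n := normc (fterm n 0 (y / 2)).
have t0 n : 0 <= t n by exact: normc_ge0.
(* Beyond [N0] a term is the difference of two partial sums, each within 1 of the limit, whence the
   2; the earlier terms are bounded by their sum. *)
pose C := 2 + \sum_(0 <= n < N0.+1) t n.
have tC n : (0 < n)%N -> t n <= C.
  move=> n0; have [nN|nN] := ltnP N0 n; last first.
    rewrite /C (bigD1_seq n) ?iota_uniq ?mem_index_iota//=.
    by rewrite addrCA lerDl addr_ge0// sumr_ge0.
  have -> : t n = normc ((f (cpx (0, y / 2)) - fsum n.-1 0 (y / 2)) -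
      (f (cpx (0, y / 2)) - fsum n 0 (y / 2))).
    rewrite /t; congr normc; case: n n0 nN => // n _ _.
have -> : fsum n.+1 0 (y / 2) = fsum n 0 (y / 2) + fterm n.+1 0 (y / 2).
      by rewrite /fsum big_nat_recr.
    move: (f _) (fterm _ _ _) (fsum _ _ _) => u v s /=.
    by rewrite opprB addrACA -opprD addrA (addrC u s) addrAC subrr add0r.
  apply: le_trans (le_normcD _ _) _; rewrite normcN /C.
  rewrite (le_trans (lerD (ltW (HN0 n.-1 _)) (ltW (HN0 n _))))//=.
  - by rewrite -ltnS prednK.
  - exact: ltnW.
  - by rewrite -[leLHS]addr0 lerD// sumr_ge0.
have C0 : 0 <= C by rewrite addr_ge0// sumr_ge0.
pose rho := expR (- (freq 1 * (y / 2))).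
have rho1 : rho < 1.
  rewrite -expR0 ltr_expR oppr_lt0 mulr_gt0// /freq mulr1 divr_gt0 ?ltr0n//.
  by rewrite mulr_gt0// pi_gt0.
have rho0 : 0 <= rho by exact: expR_ge0.
have ft n x : (0 < n)%N -> normc (fterm n x y) <= C * rho ^+ n.
  move=> n0; have -> : normc (fterm n x y) = t n * rho ^+ n.
    rewrite /t !normc_fterm -mulrA -expRM_natl -expRD; congr (_ * expR _).
    by rewrite /freq; field; rewrite pnatr_eq0 -lt0n.
  by rewrite ler_wpM2r ?exprn_ge0// tC.
exists (C / (1 - rho)) => N x.
have S : normc (fsum N x y) <= \sum_(1 <= n < N.+1) C * rho ^+ n.
  rewrite /fsum; elim: N => [|N IH].
    by rewrite !big_geq// normc0.
  rewrite [X in normc X]big_nat_recr//= [leRHS]big_nat_recr//=.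
  apply: le_trans (le_normcD _ _) _.
  by rewrite lerD// ft.
apply: le_trans S _; rewrite -mulr_sumr ler_wpM2l//.
rewrite -[leRHS]mul1r ler_pdivlMr ?subr_gt0//.
have := subrX1 rho N.+1.
rewrite -(big_mkord xpredT (fun i => rho ^+ i)) big_ltn//= expr0.
have := exprn_ge0 N.+1 rho0; set S := \sum_(1 <= _ < _) _; nra.
Qed.

Lemma measurable_Re_fterm n : measurable_fun setT
  (fun p : R * R => complex.Re (fterm n p.1 p.2)).
Proof.
under eq_fun do rewrite Re_fterm.
have mx : measurable_fun setT (fun p : R * R => freq n * p.1) by exact: measurable_funM.
have my : measurable_fun setT (fun p : R * R => - (freq n * p.2)).
  by apply: measurableT_comp => //; exact: measurable_funM.
have mcos := measurableT_comp (continuous_measurable_fun (@continuous_cos R)) mx.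
have msin := measurableT_comp (continuous_measurable_fun (@continuous_sin R)) mx.
apply: measurable_funM; first exact: (measurableT_comp (@measurable_expR R) my).
by apply: measurable_funB; apply: measurable_funM.
Qed.

Lemma measurable_Im_fterm n : measurable_fun setT
  (fun p : R * R => complex.Im (fterm n p.1 p.2)).
Proof.
under eq_fun do rewrite Im_fterm.
have mx : measurable_fun setT (fun p : R * R => freq n * p.1) by exact: measurable_funM.
have my : measurable_fun setT (fun p : R * R => - (freq n * p.2)).
  by apply: measurableT_comp => //; exact: measurable_funM.
have mcos := measurableT_comp (continuous_measurable_fun (@continuous_cos R)) mx.
have msin := measurableT_comp (continuous_measurable_fun (@continuous_sin R)) mx.
apply: measurable_funM; first exact: (measurableT_comp (@measurable_expR R) my).
by apply: measurable_funD; apply: measurable_funM.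
Qed.

Definition plane_uhp : set (R * R) := [set p | 0 < p.2].

Lemma measurable_plane_uhp : measurable plane_uhp.
Proof.
rewrite (_ : plane_uhp = snd @^-1` `]0, +oo[%classic); last first.
  by apply/seteqP; split => p /=; rewrite in_itv/= andbT.
by rewrite -[X in measurable X]setTI; exact: measurable_snd.
Qed.

(** Measurability is read off the Fourier expansion, a pointwise limit of trigonometric sums. *)
Lemma measurable_Re_uhp : measurable_fun plane_uhp (fun p => complex.Re (f (cpx p))).
Proof.
apply: (@measurable_fun_cvg _ _ _ _ (fun N p => complex.Re (fsum N p.1 p.2))).
  move=> N; apply: measurable_funTS; rewrite /fsum.
  under eq_fun do rewrite Re_sum.
  by apply: measurable_sum => n; exact: measurable_Re_fterm.
by move=> [x y] /= y0; exact: cvg_Re_fsum.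
Qed.

Lemma measurable_Im_uhp : measurable_fun plane_uhp (fun p => complex.Im (f (cpx p))).
Proof.
apply: (@measurable_fun_cvg _ _ _ _ (fun N p => complex.Im (fsum N p.1 p.2))).
  move=> N; apply: measurable_funTS; rewrite /fsum.
  under eq_fun do rewrite Im_sum.
  by apply: measurable_sum => n; exact: measurable_Im_fterm.
by move=> [x y] /= y0; exact: cvg_Im_fsum.
Qed.

Lemma measurable_normc_uhp :
  measurable_fun plane_uhp (fun p => normc (f (cpx p)) ^+ 2).
Proof.
apply: (eq_measurable_fun
  (fun p => complex.Re (f (cpx p)) ^+ 2 + complex.Im (f (cpx p)) ^+ 2)).
  by move=> p _; rewrite normc_sqr.
by apply: measurable_funD; apply: measurable_funX;
  [exact: measurable_Re_uhp|exact: measurable_Im_uhp].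
Qed.

(** Parseval holds exactly for the partial sums; dominated convergence passes to [f], and only the
    first [M] terms are kept. *)
Lemma bessel_line M y : 0 < y ->
  ((\sum_(1 <= n < M.+1) normc (b n) ^+ 2 * expR (- (2 * freq n * y)) * w%:R)%:E <=
  \int[leb]_(x in `]0%R, w%:R]) (normc (f (cpx (x, y))) ^+ 2)%:E)%E.
Proof.
move=> y0; have [C HC] := fsum_bounded y0.
have wR : 0 < w%:R :> R by rewrite ltr0n.
have C0 : 0 <= C by apply: le_trans (HC 0 0); exact: normc_ge0.
(* The strip is half open, whereas mean values are computed from primitives on the closed
   interval. *)
rewrite integral_itv_obnd_cbnd; last first.
  apply/measurable_EFinP.
  apply: (measurable_comp (F := plane_uhp) (g := fun x : R => (x, y)) _ _ measurable_normc_uhp).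
  - exact: measurable_plane_uhp.
  - by move=> _ [x _ <-].
  - by apply: measurable_funTS; exact: pair2_measurable.
have mN N : measurable_fun setT (fun x : R => normc (fsum N x y) ^+ 2).
  by apply: continuous_measurable_fun; have [] := has_mean_fsum N y.
have cvg : (\int[leb]_(x in `[0%R, w%:R]) (normc (fsum N x y) ^+ 2)%:E)%E @[N --> \oo] -->
    (\int[leb]_(x in `[0%R, w%:R]) (normc (f (cpx (x, y))) ^+ 2)%:E)%E.
  apply: (@dominated_cvg _ _ _ leb `[0%R, w%:R]%classic _ _ _ (cst (C ^+ 2)%:E)) => //.
  - move=> N; apply/measurable_EFinP; exact: (measurable_funTS (mN N)).
  - move=> x _.
    suff H : normc (fsum N x y) ^+ 2 @[N --> \oo] --> normc (f (cpx (x, y))) ^+ 2.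
      exact: (cvg_comp _ _ H).
    rewrite normc_sqr; under eq_fun do rewrite normc_sqr.
    by apply: cvgD; apply: cvgM; first [exact: cvg_Re_fsum | exact: cvg_Im_fsum].
  - apply: (@continuous_compact_integrable _ (fun=> C ^+ 2)); first exact: segment_compact.
    by apply: continuous_subspaceT => x; exact: cvg_cst.
  - by move=> N x _; rewrite gee0_abs ?lee_fin ?sqr_ge0// ler_sqr ?nnegrE ?normc_ge0.
have intE N := integral_has_mean wR (has_mean_fsum N y).
rewrite -(cvg_lim _ cvg)//; apply: lime_ge; first by apply/cvg_ex; eexists; exact: cvg.
near=> N; rewrite intE lee_fin -mulr_suml ler_wpM2r ?ler0n//.
rewrite [leRHS](big_cat_nat (n := M.+1))//=; last by near: N; exact: nbhs_infty_ge.
by rewrite lerDl sumr_ge0// => n _; rewrite mulr_ge0 ?sqr_ge0// expR_ge0.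
Unshelve. all: by end_near. Qed.
End Bessel.

(** * Integration of the invariant height function over the strip *)

Section StripIntegral.
Variable R : realType.
Local Notation leb := (@lebesgue_measure R).

(* [y^2 |f|^2], the invariant of weight 2, extended by zero to the plane. *)
Definition height_sq (f : R[i] -> R[i]) (x y : R) : R :=
  if 0 < y then y ^+ 2 * normc (f (cpx (x, y))) ^+ 2 else 0.

Lemma height_sq_ge0 f x y : 0 <= height_sq f x y.
Proof. by rewrite /height_sq; case: ifP => // _; rewrite mulr_ge0 ?sqr_ge0. Qed.

Lemma measurable_height_sq (w : nat) (f : R[i] -> R[i]) (b : nat -> R[i]) :
  fourier_expansion w f b ->
  measurable_fun setT (fun p : R * R => height_sq f p.1 p.2).
Proof.
move=> fb.
rewrite (_ : (fun p => _) =
    (fun p : R * R => p.2 ^+ 2 * normc (f (cpx p)) ^+ 2) \_ (@plane_uhp R)).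
  apply/(measurable_restrictT _ (@measurable_plane_uhp R)).
  apply: measurable_funM; last exact: (measurable_normc_uhp fb).
  by apply: measurable_funX; apply: measurable_funTS; exact: measurable_snd.
apply/funext => -[x y]; rewrite /height_sq /patch/=.
by case: ifPn => [y0|y0]; [rewrite mem_set|rewrite memNset//; exact/negP].
Qed.

Lemma measurable_strip (w : nat) (Y : R) :
  measurable (strip w Y : set (measurableTypeR R * measurableTypeR R)).
Proof.
rewrite (_ : strip w Y = `]0, w%:R]%classic `*` `[Y, +oo[%classic).
  exact: measurableX.
by apply/seteqP; split => -[x y]; rewrite /strip /= !in_itv/= andbT.
Qed.

(** The $y^2$ of [height_sq] cancels the $y^{-2}$ of the measure, so [bessel_line] is integrated
    against plain $dy$ over $y\ge Y$, term by term. *)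
Lemma strip_integral_ge (w : nat) (f : R[i] -> R[i]) (b : nat -> R[i]) M (Y : R) :
  (0 < w)%N -> fourier_expansion w f b -> 0 < Y ->
  ((\sum_(1 <= n < M.+1) normc (b n) ^+ 2 * w%:R *
     (expR (- (2 * freq R w n * Y)) / (2 * freq R w n)))%:E <=
   hyp_integral (fun x y => \1_(strip w Y) (x, y) * height_sq f x y)%R)%E.
Proof.
move=> w0 fb Y0; have mh := @measurable_haar R; have h0 := @haar_ge0 R.
have mf := measurable_height_sq fb; have mT := measurable_strip w Y.
have f0 := @height_sq_ge0 f.
have fr0 n : (0 < n)%N -> 0 < 2 * freq R w n.
  by move=> n0; rewrite /freq mulr_gt0// divr_gt0 ?mulr_gt0 ?ltr0n// pi_gt0.
pose k x y : R := haar y * (haar y * (\1_(strip w Y) (x, y) * height_sq f x y)).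
have k0 x y : 0 <= k x y by rewrite !mulr_ge0// indicE.
have mk : measurable_fun setT (fun p : R * R => k p.1 p.2).
  apply: (measurable_hyp_density (k := fun x y => \1_(strip w Y) (x, y) * height_sq f x y)).
  apply: measurable_funM => //.
  by under eq_fun do rewrite -surjective_pairing; exact: measurable_indic.
rewrite /hyp_integral (integral_swap (w := k))//.
pose L n (y : R) : R := normc (b n) ^+ 2 * w%:R * expR (- (2 * freq R w n * y)).
have L0 n y : 0 <= L n y by rewrite /L mulr_ge0 ?expR_ge0// mulr_ge0 ?sqr_ge0.
have mE n : measurable_fun setT (fun y : R => expR (- (2 * freq R w n * y))).
  apply: (measurableT_comp (@measurable_expR R)).
  by apply: measurableT_comp => //; exact: measurable_funM.
have mL n : measurable_fun setT (L n) by apply: measurable_funM.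
have mswap : measurable_fun setT (fun y => \int[leb]_x (k x y)%:E)%E.
  apply: (measurable_inner_integral (w := fun y x => k x y)) => //.
  exact: (measurable_comp2 (k := k) mk measurable_snd measurable_fst).
apply: (@le_trans _ _ (\int[leb]_(y in `[Y, +oo[) (\sum_(1 <= n < M.+1) (L n y)%:E))%E); last first.
  apply: (@le_trans _ _ (\int[leb]_(y in `[Y, +oo[) (\int[leb]_x (k x y)%:E))%E); last first.
    apply: ge0_subset_integral => //.
    by move=> y _; apply: integral_ge0 => x _; rewrite lee_fin.
  apply: ge0_le_integral => //.
  - by move=> y _; apply: sume_ge0 => n _; rewrite lee_fin.
  - apply: emeasurable_sum => n; apply/measurable_EFinP.
    exact: measurable_funTS (mL n).
  - exact: measurable_funTS.
  move=> y /=; rewrite in_itv/= andbT => Yy.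
  have y0 : 0 < y by exact: lt_le_trans Yy.
  have := bessel_line w0 fb M y0.
  rewrite (_ : \int[leb]_(x in _) _ = \int[leb]_x (k x y)%:E)%E; last first.
    rewrite integral_mkcond; apply: eq_integral => x _.
    rewrite /patch /k indicE /height_sq y0 /haar y0.
    have -> : ((x, y) \in strip w Y) = (x \in `]0%R, w%:R]%classic).
      by apply/idP/idP; rewrite !inE /strip/= in_itv/= => // -[].
    case: ifP => _; last by rewrite mul0r !mulr0.
    by congr EFin; rewrite mul1r; field; rewrite gt_eqF.
  apply: le_trans; rewrite sumEFin lee_fin le_eqVlt; apply/orP; left; apply/eqP.
  by apply: eq_bigr => n _; rewrite /L mulrAC.
rewrite ge0_integral_sum//; last 2 first.
- by move=> n; apply/measurable_EFinP; exact: measurable_funTS (mL n).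
- by move=> n y _; rewrite lee_fin.
rewrite -sumEFin le_eqVlt; apply/orP; left; apply/eqP.
rewrite big_nat_cond [RHS]big_nat_cond; apply: eq_bigr => n /andP[/andP[n0 _] _].
rewrite EFinM -integral_expR_ray ?fr0// -ge0_integralZl//.
- by apply/measurable_EFinP; exact: measurable_funTS (mE n).
- by rewrite lee_fin mulr_ge0 ?sqr_ge0.
Qed.
End StripIntegral.

(** * The large sieve inequality *)

Section Combinations.
Variable R : realType.
Local Notation mu := (@plane_measure R).

Lemma fourier_expansion_sum (w k : nat) (f : 'I_k -> R[i] -> R[i])
    (af : 'I_k -> nat -> R[i]) (c : 'I_k -> R[i]) :
  (forall j, fourier_expansion w (f j) (af j)) ->
  fourier_expansion w (fun z => \sum_j c j * f j z) (fun n => \sum_j c j * af j n).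
Proof.
move=> fe z z0.
rewrite (_ : (fun N => _) = (fun N => \sum_(j < k) c j *
    \sum_(1 <= n < N.+1) af j n * e (n%:R * z / w%:R) : R[i]^o)); last first.
  apply/funext => N; under [RHS]eq_bigr do rewrite mulr_sumr.
  rewrite exchange_big/=; apply: eq_bigr => n _.
  by rewrite mulr_suml; apply: eq_bigr => j _; rewrite mulrA.
elim: (index_enum _) => [|j r IH].
  by under eq_fun do rewrite big_nil; rewrite big_nil; exact: cvg_cst.
under eq_fun do rewrite big_cons; rewrite big_cons.
apply: cvgD IH; apply: cvgM; [exact: cvg_cst|exact: fe].
Qed.

Lemma normc_mobius_den (g : 'M[int]_2) (x y : R) :
  normc ((g 1 0)%:~R * cpx (x, y) + (g 1 1)%:~R) ^+ 2 = mob_den g x y.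
Proof.
rewrite normc_sqr -!(rmorph_int (real_complex R))/=.
by rewrite !(mul0r, subr0, addr0, add0r).
Qed.

Lemma slash2_mobius (g : 'M[int]_2) (f : R[i] -> R[i]) (x y : R) :
  SL2Z g -> 0 < y -> slash2 g f (cpx (x, y)) = f (cpx (x, y)) ->
  f (mobius g (cpx (x, y))) =
    ((g 1 0)%:~R * cpx (x, y) + (g 1 1)%:~R) ^+ 2 * f (cpx (x, y)).
Proof.
move=> dg y0; rewrite /slash2 => <-.
have den0 : (g 1 0)%:~R * cpx (x, y) + (g 1 1)%:~R != 0 :> R[i].
  apply/eqP => den0; have := normc_mobius_den g x y.
  by rewrite den0 normc0 expr0n/= => /esym/eqP; rewrite gt_eqF// mob_den_gt0.
by rewrite mulVKf// expf_neq0.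
Qed.

(** The squared height loses the factor [mob_den ^+ 2], which $|f|^2$ gains in weight 2. The
    hypothesis is linear in [f], hence stable under linear combinations. *)
Lemma height_sq_mob (g : 'M[int]_2) (f : R[i] -> R[i]) (x y : R) :
  SL2Z g -> 0 < y ->
  f (mobius g (cpx (x, y))) =
    ((g 1 0)%:~R * cpx (x, y) + (g 1 1)%:~R) ^+ 2 * f (cpx (x, y)) ->
  height_sq f (mob_re g x y) (mob_im g x y) = height_sq f x y.
Proof.
move=> dg y0; rewrite cpx_mobius// /height_sq y0 mob_im_gt0// => ->.
set v := f _; set d := _ + _.
have -> : normc (d ^+ 2 * v) ^+ 2 = mob_den g x y ^+ 2 * normc v ^+ 2.
  have dd : normc (d ^+ 2) = mob_den g x y by rewrite expr2 normcM -expr2 normc_mobius_den.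
  by rewrite normcM dd exprMn.
by rewrite /mob_im; field; rewrite gt_eqF// mob_den_gt0.
Qed.

Lemma normc_real (x : R) : normc x%:C = `|x|.
Proof. by rewrite /= expr0n/= addr0 sqrtr_sqr. Qed.

Lemma norm_dot_le (x y x' y' : R) :
  `|x * x' + y * y'| <= x ^+ 2 + y ^+ 2 + (x' ^+ 2 + y' ^+ 2).
Proof.
have h1 := sqr_ge0 (x + x'); have h2 := sqr_ge0 (x - x').
have h3 := sqr_ge0 (y + y'); have h4 := sqr_ge0 (y - y').
have h5 := sqr_ge0 x; have h6 := sqr_ge0 y.
have h7 := sqr_ge0 x'; have h8 := sqr_ge0 y'.
by rewrite ler_norml; apply/andP; split; nra.
Qed.

(** Pythagoras for an orthonormal family, stated with the extended integral that the unfolding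
    needs. Expanding requires integrable products, which are dominated by the squares
    $|f_i|^2+|f_j|^2$. *)
Lemma petersson_combination (k : nat) (F : set R[i]) (f : 'I_k -> R[i] -> R[i])
    (w : nat) (af : 'I_k -> nat -> R[i]) (c : 'I_k -> R[i]) :
  measurable (@cpx R @^-1` F : set (measurableTypeR R * measurableTypeR R)) ->
  F `<=` @upper_half_plane R ->
  (forall j, fourier_expansion w (f j) (af j)) ->
  (forall i j, petersson F (f i) (f j) = (i == j)%:R) ->
  (\int[mu]_(p in @cpx R @^-1` F) (normc (\sum_j c j * f j (cpx p)) ^+ 2)%:E =
   (\sum_j normc (c j) ^+ 2)%:E)%E.
Proof.
move=> mE FH fe ortho; set E := @cpx R @^-1` F.
have EH : E `<=` @plane_uhp R by move=> [x y] /FH.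
pose re j p := complex.Re (f j (cpx p)); pose im j p := complex.Im (f j (cpx p)).
have mre j : measurable_fun E (re j).
  apply: (measurable_funS _ EH); first exact: measurable_plane_uhp.
  exact: (measurable_Re_uhp (fe j)).
have mim j : measurable_fun E (im j).
  apply: (measurable_funS _ EH); first exact: measurable_plane_uhp.
  exact: (measurable_Im_uhp (fe j)).
have hRe i j p : complex.Re (f i (cpx p) * (f j (cpx p))^*%C) =
    re i p * re j p + im i p * im j p.
  by rewrite /re /im; case: (f i _) (f j _) => [a b] [a' b'] /=; rewrite mulrN opprK.
have hIm i j p : complex.Im (f i (cpx p) * (f j (cpx p))^*%C) =
    im i p * re j p - re i p * im j p.
  by rewrite /re /im; case: (f i _) (f j _) => [a b] [a' b'] /=; ring.
(* a divergent integral would give the junk value [fine +oo = 0] instead of 1 *)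
have intsq j : mu.-integrable E (fun p => (re j p ^+ 2 + im j p ^+ 2)%:E).
  have m2 : measurable_fun E (fun p => (re j p ^+ 2 + im j p ^+ 2)).
    by apply: measurable_funD; apply: measurable_funX.
  apply/integrableP; split; first exact/measurable_EFinP.
  under eq_integral do rewrite gee0_abs ?lee_fin ?addr_ge0 ?sqr_ge0//.
  set I := integral _ _ _.
  have fI : fine I = 1.
    have := congr1 (@complex.Re R) (ortho j j); rewrite eqxx /petersson/= /Rintegral.
    under eq_integral do rewrite hRe -!expr2.
    by move=> ->.
  case: I fI => [r _| /= /eqP|_] //; first exact: ltry.
  by rewrite eq_sym oner_eq0.
have mRe i j : measurable_fun E (fun p => re i p * re j p + im i p * im j p).
  by apply: measurable_funD; apply: measurable_funM.
have mIm i j : measurable_fun E (fun p => im i p * re j p - re i p * im j p).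
  by apply: measurable_funB; apply: measurable_funM.
have intRe i j : mu.-integrable E (fun p => (re i p * re j p + im i p * im j p)%:E).
  apply: (@le_integrable _ _ _ mu E _ _
    (fun p => (re i p ^+ 2 + im i p ^+ 2)%:E + (re j p ^+ 2 + im j p ^+ 2)%:E)%E) => //.
  - apply/measurable_EFinP; exact: mRe.
  - move=> p _; rewrite -EFinD !abse_EFin lee_fin [leRHS]ger0_norm ?addr_ge0 ?sqr_ge0//.
    exact: norm_dot_le.
  - exact: integrableD.
have intIm i j : mu.-integrable E (fun p => (im i p * re j p - re i p * im j p)%:E).
  apply: (@le_integrable _ _ _ mu E _ _
    (fun p => (re i p ^+ 2 + im i p ^+ 2)%:E + (re j p ^+ 2 + im j p ^+ 2)%:E)%E) => //.
  - apply/measurable_EFinP; exact: mIm.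
  - move=> p _; rewrite -EFinD !abse_EFin lee_fin [leRHS]ger0_norm ?addr_ge0 ?sqr_ge0//.
    by rewrite (addrC (re i p ^+ 2)) -mulrN -[im j p ^+ 2]sqrrN norm_dot_le.
  - exact: integrableD.
have valRe i j : (\int[mu]_(p in E) (re i p * re j p + im i p * im j p)%:E = ((i == j)%:R)%:E)%E.
  rewrite -[LHS]fineK ?integrable_fin_num//; congr EFin.
  have := congr1 (@complex.Re R) (ortho i j); rewrite /petersson/= /Rintegral.
  under eq_integral do rewrite hRe.
  by move=> ->; case: (i == j).
have valIm i j : (\int[mu]_(p in E) (im i p * re j p - re i p * im j p)%:E = 0)%E.
  rewrite -[LHS]fineK ?integrable_fin_num//; congr EFin.
  have := congr1 (@complex.Im R) (ortho i j); rewrite /petersson/= /Rintegral.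
  under eq_integral do rewrite hIm.
  by move=> ->; case: (i == j).
pose u j := complex.Re (c j); pose v j := complex.Im (c j).
(* The real part of $c_i\overline{c_j}\cdot f_i\overline{f_j}$, as product of real parts minus
   product of imaginary parts. *)
have expand p : normc (\sum_j c j * f j (cpx p)) ^+ 2 = \sum_i \sum_j
    ((u i * u j + v i * v j) * (re i p * re j p + im i p * im j p) -
     (v i * u j - u i * v j) * (im i p * re j p - re i p * im j p)).
  rewrite normc_sqr Re_sum Im_sum !expr2 !big_distrlr -big_split/=.
  apply: eq_bigr => i _; rewrite -big_split/=; apply: eq_bigr => j _.
  rewrite /u /v /re /im; case: (c i) (c j) (f i _) (f j _) => [? ?] [? ?] [? ?] [? ?] /=; ring.
under eq_integral do rewrite expand -sumEFin.
rewrite integral_sum//; last first.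
  move=> i; rewrite (_ : (fun p => _) = (fun p => \sum_j
    ((u i * u j + v i * v j)%:E * (re i p * re j p + im i p * im j p)%:E -
     (v i * u j - u i * v j)%:E * (im i p * re j p - re i p * im j p)%:E))%E); last first.
    by apply/funext => p; rewrite -sumEFin.
  apply: integrable_sum => // j _; apply: integrableB => //; exact: integrableZl.
rewrite -sumEFin; apply: eq_bigr => i _.
under eq_integral do rewrite -sumEFin.
rewrite integral_sum//; last first.
  by move=> j; apply: (@integrableB _ _ _ mu E mE
    (fun p => (u i * u j + v i * v j)%:E * (re i p * re j p + im i p * im j p)%:E)%E
    (fun p => (v i * u j - u i * v j)%:E * (im i p * re j p - re i p * im j p)%:E)%E);
    exact: integrableZl.
rewrite (bigD1 i)//= big1 => [|j ji].
  rewrite adde0; under eq_integral do rewrite EFinB EFinM EFinM.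
  rewrite integralB//; try exact: integrableZl.
  rewrite !integralZl// valRe valIm eqxx mule0 mule1 sube0 normc_sqr.
  by rewrite -/(u i) -/(v i) !expr2.
under eq_integral do rewrite EFinB EFinM EFinM.
rewrite integralB//; try exact: integrableZl.
by rewrite !integralZl// valRe valIm eq_sym (negbTE ji) !mule0 sube0.
Qed.

(** Take $c_j=\overline{L_j}$, so that $S=\sum_j|L_j|^2$ is both the squared norm of $g$ and the
    linear form in $a$ evaluated on the coefficients of $g$. The analytic part gives $B\le DS$ for
    the weighted square sum $B$ of these coefficients; then $S\le(D\|a\|^2+B/D)/2$ leaves $S/2$ to
    be absorbed. *)
Lemma sum_linform_le (q : nat) (G : set 'M[int]_2) (w : nat) (F : set R[i])
    (k : nat) (f : 'I_k -> R[i] -> R[i]) (af : 'I_k -> nat -> R[i])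
    (K : R) (a : nat -> R[i]) :
  is_subgroup G -> (0 < q)%N -> G `<=` Gamma0 q -> is_width G w ->
  fundamental_domain G F ->
  (forall j g z, G g -> upper_half_plane z -> slash2 g (f j) z = f j z) ->
  (forall i j, petersson F (f i) (f j) = (i == j)%:R) ->
  (forall j, fourier_expansion w (f j) (af j)) ->
  0 < K ->
  \sum_(j < k) normc (linform (af j) a K) ^+ 2 <=
    expR (4 * pi) / w%:R ^+ 2 * (2 + 6 * (K / (q%:R * w%:R))) * sqnorm a K.
Proof.
move=> sG q0 GG Gw FD inv ortho fe K0.
have [GS _ _ _] := sG; have w0 : (0 < w)%N by have [[]] := Gw.
have [mE FH _] := FD.
have wR : 0 < w%:R :> R by rewrite ltr0n.
have qR : 0 < q%:R :> R by rewrite ltr0n.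
have pR : 0 < pi :> R by exact: pi_gt0.
have eR : 0 < expR (4 * pi) :> R by exact: expR_gt0.
pose L j := linform (af j) a K.
pose c j := (L j)^*%C.
pose g z := \sum_j c j * f j z.
pose b n := \sum_j c j * af j n.
have gb : fourier_expansion w g b by exact: fourier_expansion_sum.
pose S := \sum_(j < k) normc (L j) ^+ 2.
pose B := \sum_(1 <= n < (Num.truncn K).+1) normc (b n) ^+ 2 / (4 * pi * n%:R).
pose mult := 2 + 6 * (K / (q%:R * w%:R)).
have mult0 : 0 < mult.
  by rewrite ltr_pwDl// mulr_ge0// divr_ge0 ?ltW// mulr_gt0.
have normL j : normc (c j) = normc (L j).
  by rewrite /c; case: (L j) => x y /=; rewrite sqrrN.
(* At this height the decay is $e^{-4\pi n/K}\ge e^{-4\pi}$ for $n\le K$, and $6/(qY)$ becomes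
   $6K/(qw)$. *)
pose Y := w%:R / K.
have Y0 : 0 < Y by rewrite divr_gt0.
have unfold : (hyp_integral (fun x y => \1_(strip w Y) (x, y) * height_sq g x y)%R <=
    mult%:E * S%:E)%E.
  have -> : S%:E = hyp_integral (fun x y => \1_(@cpx R @^-1` F) (x, y) * height_sq g x y)%R.
    have <- : (\int[mu]_(p in @cpx R @^-1` F) (normc (g (cpx p)) ^+ 2)%:E = S%:E)%E.
      rewrite (petersson_combination c mE FH fe ortho); congr EFin.
      by apply: eq_bigr => j _; rewrite normL.
    rewrite hyp_integral_plane; last 2 first.
    - apply: measurable_funM; last exact: measurable_height_sq gb.
      by under eq_fun do rewrite -surjective_pairing; exact: measurable_indic.
    - by move=> x y; rewrite mulr_ge0 ?height_sq_ge0// indicE.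
    rewrite integral_mkcond; apply: eq_integral => -[x y] _.
    rewrite /patch /hyp_density/= indicE; case: ifPn => [|_]; last by rewrite mul0r !mulr0.
    rewrite inE => /FH /= y0; congr EFin; rewrite /height_sq /haar y0 mul1r.
    by field; rewrite gt_eqF.
  apply: (hyp_integral_unfold_le (G := G)) => //.
  - exact: measurable_strip.
  - exact: measurable_height_sq gb.
  - by move=> x y; exact: height_sq_ge0.
  - move=> h x y Gh y0; apply: height_sq_mob => //; first exact: GS.
    rewrite /g mulr_sumr; apply: eq_bigr => j _.
    rewrite (slash2_mobius (GS _ Gh) y0) ?inv//; ring.
  - exact: ltW.
  - move=> x y s y0 us Hs.
    have := size_orbit_strip sG GG q0 Gw Y0 y0 us Hs.
    rewrite /mult /Y; congr (_ <= 2 + _).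
    by field; rewrite !gt_eqF.
have BS : w%:R ^+ 2 * expR (- (4 * pi)) * B <= mult * S.
  rewrite -lee_fin EFinM; apply: le_trans unfold.
  apply: le_trans (strip_integral_ge (Num.truncn K) w0 gb Y0).
  rewrite lee_fin /B mulr_sumr big_nat_cond [leRHS]big_nat_cond.
  apply: ler_sum => n /andP[/andP[n0 nK] _].
  have nR : 0 < n%:R :> R by rewrite ltr0n.
  have nK' : n%:R <= K by rewrite -truncn_ge_nat ?ltW// -ltnS.
  (* As $2\,\mathrm{freq}(n)=4\pi n/w$, the division yields the second factor $w$ and the weight
     $1/(4\pi n)$. *)
  have -> : normc (b n) ^+ 2 * w%:R * (expR (- (2 * freq R w n * Y)) / (2 * freq R w n)) =
      w%:R ^+ 2 * expR (- (2 * freq R w n * Y)) * (normc (b n) ^+ 2 / (4 * pi * n%:R)).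
    rewrite /freq; move: (pi : R) pR => P P0.
    by field; rewrite !gt_eqF.
  rewrite ler_wpM2r ?divr_ge0 ?sqr_ge0 ?mulr_ge0 ?pi_ge0// ler_wpM2l ?sqr_ge0//.
  rewrite ler_expR lerN2 /freq /Y.
  have -> : 2 * (2 * pi * n%:R / w%:R) * (w%:R / K) = 4 * pi * (n%:R / K).
    by field; rewrite !gt_eqF.
  by rewrite ler_piMr ?mulr_ge0 ?pi_ge0// ler_pdivrMr ?mul1r.
pose D := expR (4 * pi) / w%:R ^+ 2 * mult.
have D0 : 0 < D by rewrite /D mulr_gt0// divr_gt0 ?expR_gt0// exprn_gt0.
have BD : B <= D * S.
  have ew : 0 < w%:R ^+ 2 * expR (- (4 * pi)) :> R.
    by rewrite mulr_gt0 ?expR_gt0// exprn_gt0.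
  rewrite -(ler_pM2l ew); apply: le_trans BS _.
  rewrite /D expRN le_eqVlt; apply/orP; left; apply/eqP.
  move: (expR (4 * pi)) eR => P P0.
  by field; rewrite !gt_eqF.
have SE : S%:C = \sum_(1 <= n < (Num.truncn K).+1)
    a n * (b n / (Num.sqrt (4 * pi * n%:R))%:C).
  have -> : S%:C = \sum_j c j * L j.
    rewrite /S rmorph_sum; apply: eq_bigr => j _.
    rewrite normc_sqr /c; case: (L j) => x y /=; apply/eqP.
    by rewrite eq_complex/=; apply/andP; split; apply/eqP; ring.
  rewrite /L /linform; under eq_bigr do rewrite mulr_sumr.
  rewrite exchange_big/=; apply: eq_bigr => n _.
  by rewrite /b mulr_suml mulr_sumr; apply: eq_bigr => j _; ring.
have S0 : 0 <= S by apply: sumr_ge0 => j _; exact: sqr_ge0.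
have half (s t : R) : s <= (t + s) / 2 -> s <= t by lra.
apply: half; rewrite -/mult -/D -/S.
have normS : S = normc S%:C by rewrite normc_real ger0_norm.
rewrite normS SE.
(* AM-GM with the weight [D] replaces the Cauchy-Schwarz inequality *)
apply: (@le_trans _ _ (\sum_(1 <= n < (Num.truncn K).+1)
    (D * normc (a n) ^+ 2 + D^-1 * (normc (b n) ^+ 2 / (4 * pi * n%:R))) / 2)).
  rewrite big_nat_cond [leRHS]big_nat_cond.
  elim/big_ind2: _ => [|x1 x2 y1 y2 h1 h2|n /andP[/andP[n0 _] _]].
  - by rewrite normc0.
  - by apply: le_trans (le_normcD _ _) _; exact: lerD.
  have n4 : 0 < 4 * pi * n%:R :> R by rewrite !mulr_gt0 ?pi_gt0// ltr0n.
  rewrite !normcM normcV.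
  have -> : normc (Num.sqrt (4 * pi * n%:R : R))%:C = Num.sqrt (4 * pi * n%:R).
    by rewrite normc_real ger0_norm// sqrtr_ge0.
  have s0 : 0 < Num.sqrt (4 * pi * n%:R : R) by rewrite sqrtr_gt0.
  rewrite -[in leRHS](sqr_sqrtr (ltW n4)).
  move: (normc (a n)) (normc (b n)) (Num.sqrt _) s0 => x y s s0.
  rewrite ler_pdivlMr// -subr_ge0.
  have -> : D * x ^+ 2 + D^-1 * (y ^+ 2 / s ^+ 2) - x * (y / s) * 2 =
      (D * x - y / s) ^+ 2 / D by field; rewrite !gt_eqF.
  by rewrite divr_ge0 ?sqr_ge0// ltW.
rewrite -mulr_suml big_split/= -!mulr_sumr ler_wpM2r//.
by rewrite -SE -normS lerD2l -(ler_pM2l D0) mulVKf ?gt_eqF.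
Qed.
End Combinations.

Theorem proposition10p4 (R : realType) :
  (exists C1 C2 : R, 0 < C1 /\ 0 < C2 /\
    forall (q : nat) (G : set 'M[int]_2) (w : nat) (F : set R[i])
      (k : nat) (f : 'I_k -> R[i] -> R[i]) (af : 'I_k -> nat -> R[i])
      (K : R) (a : nat -> R[i]),
    is_congruence_subgroup G -> is_level G q -> G `<=` Gamma0 q ->
    is_width G w ->
    fundamental_domain G F -> orthonormal_basis G F f ->
    (forall j, fourier_expansion w (f j) (af j)) ->
    2 <= K ->
    \sum_(j < k) normc (linform (af j) a K) ^+ 2 <=
      C1 * (w%:R ^+ 2)^-1 * (ln K + C2 * (K / (q%:R * w%:R))) * sqnorm a K)
  /\
  (forall (A : R -> R) (eps : R), 0 < eps ->
    exists C1 C2 : R, 0 < C1 /\ 0 < C2 /\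
    forall (q : nat) (G : set 'M[int]_2) (w : nat) (F : set R[i])
      (k : nat) (f : 'I_k -> R[i] -> R[i]) (af : 'I_k -> nat -> R[i])
      (K : R) (a : nat -> R[i]),
    is_congruence_subgroup G -> is_level G q -> G `<=` Gamma0 q ->
    is_width G w ->
    fundamental_domain G F -> orthonormal_basis G F f ->
    (forall j, fourier_expansion w (f j) (af j)) ->
    2 <= K ->
    kloosterman_bound G w A ->
    \sum_(j < k) normc (linform (af j) a K) ^+ 2 <=
      C1 * (w%:R `^ (2 - eps))^-1 * (1 + C2 * (K / (q%:R * w%:R)))
      * sqnorm a K).
Proof.
have E0 : 0 < expR (4 * pi) :> R by exact: expR_gt0.
split.
  have ln20 : 0 < ln 2 :> R by rewrite ln_gt0// ltr1n.
  (* The product of the constants is $6e^{4\pi}$, matching the term in $K/(qw)$ exactly; the other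
     term uses $2\le2\log K/\log2$. *)
  exists (2 * expR (4 * pi) / ln 2), (3 * ln 2); split; first by rewrite divr_gt0 ?mulr_gt0.
  split; first by rewrite mulr_gt0.
  move=> q G w F k f af K a [sG _] [[q0 _] _] GG Gw FD [cusp ortho _] fe K2.
  have K0 : 0 < K by apply: lt_le_trans K2.
  have inv j g z : G g -> upper_half_plane z -> slash2 g (f j) z = f j z.
    by have [_ H _] := cusp j; exact: H.
  apply: le_trans (sum_linform_le a sG q0 GG Gw FD inv ortho fe K0) _.
  have w0 : (0 < w)%N by have [[]] := Gw.
  have wR : 0 < w%:R :> R by rewrite ltr0n.
  rewrite ler_wpM2r//; first by apply: sumr_ge0 => n _; exact: sqr_ge0.
  set X := K / _; set E := expR _.
  have -> : 2 * E / ln 2 * (w%:R ^+ 2)^-1 * (ln K + 3 * ln 2 * X) =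
      E / w%:R ^+ 2 * (2 * (ln K / ln 2) + 6 * X).
    by clearbody E; move: (ln 2) ln20 => l l0; field; rewrite !gt_eqF.
  rewrite ler_wpM2l ?divr_ge0 ?sqr_ge0 ?expR_ge0// lerD2r.
  by rewrite ler_peMr// ler_pdivlMr// mul1r ler_ln ?posrE.
move=> A eps eps0.
exists (2 * expR (4 * pi)), 3; split; first by rewrite mulr_gt0.
split; first by [].
move=> q G w F k f af K a [sG _] [[q0 _] _] GG Gw FD [cusp ortho _] fe K2 _.
have K0 : 0 < K by apply: lt_le_trans K2.
have inv j g z : G g -> upper_half_plane z -> slash2 g (f j) z = f j z.
  by have [_ H _] := cusp j; exact: H.
apply: le_trans (sum_linform_le a sG q0 GG Gw FD inv ortho fe K0) _.
have w0 : (0 < w)%N by have [[]] := Gw.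
have wR : 0 < w%:R :> R by rewrite ltr0n.
have X0 : 0 <= K / (q%:R * w%:R) by rewrite divr_ge0 ?mulr_ge0 ?ler0n// ltW.
rewrite ler_wpM2r//; first by apply: sumr_ge0 => n _; exact: sqr_ge0.
set X := K / _ in X0 *; set E := expR _.
have -> : 2 * E * (w%:R `^ (2 - eps))^-1 * (1 + 3 * X) =
    E / w%:R `^ (2 - eps) * (2 + 6 * X).
  by field; rewrite gt_eqF// powR_gt0.
have Z0 : 0 <= 2 + 6 * X by rewrite addr_ge0// mulr_ge0.
rewrite ler_wpM2r//; apply: ler_wpM2l; first exact: expR_ge0.
(* Because $w\ge1$, lowering the exponent from $2$ to $2-\epsilon$ can only increase the inverse
   power. *)
rewrite lef_pV2 ?posrE ?powR_gt0 ?exprn_gt0// -powR_mulrn ?ler0n//.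
by rewrite ler_powR ?ler1n// lerBlDr lerDl ltW.
Qed.
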